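(* Let $n,d,q,s\ge 1$ be integers, $\mathbf{x}_1,\dots,\mathbf{x}_n\in\mathbb{R}^d$, $\mathbf{y}\in\mathbb{R}^n$, $\lambda>0$. Let $\mathbf{K}\in\mathbb{R}^{n\times n}$ be the kernel matrix of the degree-$q$ homogeneous polynomial kernel, $\mathbf{K}_{ij}=(\mathbf{x}_i^T\mathbf{x}_j)^q$, let $s_\lambda(\mathbf{K})=\mathrm{Tr}\left((\mathbf{K}+\lambda \mathbf{I}_n)^{-1}\mathbf{K}\right)$, let $\varphi:\mathbb{R}^d\to\mathbb{R}^s$ be a random TensorSketch map of degree $q$, and let $\mathbf{Z}\in\mathbb{R}^{n\times s}$ be the matrix with rows $\varphi(\mathbf{x}_1)^T,\dots,\varphi(\mathbf{x}_n)^T$. Let $\mathbf{P}\in\mathbb{R}^{n\times n}$ be the orthogonal projection matrix onto the subspace spanned by the eigenvectors of $\mathbf{Z}\mathbf{Z}^T$ whose corresponding eigenvalues are bigger than $0.05\lambda$, and let $\mathbf{V}_q$ be a matrix with $\mathbf{K}=\mathbf{V}_q\mathbf{V}_q^T$. Consider the conditions: 1. $\|(\mathbf{I}_n-\mathbf{P})\mathbf{K}(\mathbf{I}_n-\mathbf{P})\|_2\le 0.1\lambda$; 2. for all $\mathbf{x}\in\mathbb{R}^n$, $\ 0.9\,\|\mathbf{Z}^T\mathbf{P}\mathbf{x}\|_2^2\le\|\mathbf{V}_q^T\mathbf{P}\mathbf{x}\|_2^2\le 1.1\,\|\mathbf{Z}^T\mathbf{P}\mathbf{x}\|_2^2$.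 (a) If conditions 1 and 2 hold, then for every $\epsilon>0$, after $T=\left\lceil\frac{\sqrt3}{2}\ln(2/\epsilon)\right\rceil$ iterations of the preconditioned conjugate gradient method (PCG) on $(\mathbf{K}+\lambda \mathbf{I}_n)\mathbf{c}=\mathbf{y}$, starting from the all-zeros vector and with $\mathbf{Z}\mathbf{Z}^T+\lambda \mathbf{I}_n$ as a preconditioner, one obtains a vector $\tilde{\mathbf{c}}$ such that $$\|\tilde{\mathbf{c}}-\mathbf{c}\|_{\mathbf{K}+\lambda \mathbf{I}_n}\le\epsilon\,\|\mathbf{c}\|_{\mathbf{K}+\lambda \mathbf{I}_n},$$ where $\mathbf{c}$ is the exact solution of $(\mathbf{K}+\lambda \mathbf{I}_n)\mathbf{c}=\mathbf{y}$. (b) Moreover, there is a sufficiently large constant $C$ (depending only on $q$) such that for every $\delta\in(0,1)$, if $s\ge C\,s_\lambda(\mathbf{K})^2/\delta$, then with probability at least $1-\delta$ conditions 1 and 2 both hold.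
   Context: For a symmetric positive definite matrix $\mathbf{A}$, $\|\mathbf{x}\|_{\mathbf{A}}=\sqrt{\mathbf{x}^T\mathbf{A}\mathbf{x}}$; $\|\cdot\|_2$ is the Euclidean norm for vectors and the spectral norm for matrices. Write $[m]=\{1,\dots,m\}$. TensorSketch. Let $h_1,\dots,h_q:[d]\to[s]$ be $3$-wise independent (uniform) random hash functions and $g_1,\dots,g_q:[d]\to\{+1,-1\}$ be $4$-wise independent (uniform) random sign functions, all $2q$ functions chosen independently of each other. Define $H:[d]^q\to[s]$ and $G:[d]^q\to\{+1,-1\}$ by $$H(i_1,\dots,i_q)\equiv h_1(i_1)+\cdots+h_q(i_q) \bmod s,\qquad G(i_1,\dots,i_q)=g_1(i_1)g_2(i_2)\cdots g_q(i_q),$$ where residues mod $s$ are identified with $[s]$. The TensorSketch matrix $\mathbf{S}\in\mathbb{R}^{s\times d^q}$ has columns indexed by $[d]^q$, and its column $(i_1,\dots,i_q)$ is $G(i_1,\dots,i_q)\,\mathbf{e}_{H(i_1,\dots,i_q)}$, with $\mathbf{e}_j$ the $j$-th standard basis vector of $\mathbb{R}^s$. Let $v_q:\mathbb{R}^d\to\mathbb{R}^{d^q}$ map $\mathbf{x}$ to the vector with entries $x_{i_1}\cdots x_{i_q}$ indexed by $(i_1,\dots,i_q)\in[d]^q$. The TensorSketch map is $\varphi(\mathbf{x})=\mathbf{S}v_q(\mathbf{x})$. Probability is over the choice of the hash and sign functions. PCG is considered in exact arithmetic. For a positive definite system $\mathbf{A}\mathbf{c}=\mathbf{y}$ with positive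 definite preconditioner $\mathbf{M}$ and zero initial vector, the $t$-th PCG iterate is the minimizer of $\|\mathbf{x}-\mathbf{c}\|_{\mathbf{A}}$ over $\mathbf{x}$ in the Krylov subspace $\mathrm{span}\{(\mathbf{M}^{-1}\mathbf{A})^j\mathbf{M}^{-1}\mathbf{y}: 0\le j<t\}$. (For $t\le 0$ the iterate is the zero initial vector.) *)

(* Defs.v *)
(* MathComp, with MathComp-Analysis for the reals and probability. *)
From HB Require Import structures.
From mathcomp Require Import all_boot all_order all_algebra.
From mathcomp Require Import all_classical all_reals all_analysis.
From mathcomp Require Import polyrcf.

Set Implicit Arguments.
Unset Strict Implicit.
Unset Printing Implicit Defensive.

Import Order.TTheory GRing.Theory Num.Theory.
Local Open Scope classical_set_scope.
Local Open Scope ring_scope.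

Section Norms.
Context {R : realType}.

Definition normA n (A : 'M[R]_n) (x : 'cV[R]_n) : R :=
  Num.sqrt ((x^T *m A *m x) 0 0).

(* the library norm on matrices is the sup norm of the entries *)
Definition norm2 n (x : 'cV[R]_n) : R := Num.sqrt (\sum_i x i 0 ^+ 2).

Definition spectral_norm m n (A : 'M[R]_(m, n)) : R :=
  sup [set norm2 (A *m x) | x in [set x : 'cV[R]_n | norm2 x <= 1]].

End Norms.

Section Projection.
Context {R : realType}.

(* Orthogonal projection onto the row space of U: kermx U^T is its orthogonal
   complement, and proj_mx projects onto the first space along the second. *)
Definition orthproj n (U : 'M[R]_n) : 'M[R]_n := proj_mx U (kermx U^T).

(* Row space spanned by the eigenvectors of A with eigenvalue > t. As
   [eigenspace] is made of row (left) eigenvectors, this is to be used with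
   symmetric A. *)
Definition eigenspan_gt n (A : 'M[R]_n) (t : R) : 'M[R]_n :=
  (\sum_(a <- rootsR (char_poly A) | (t < a)%R) eigenspace A a)%MS.

End Projection.

Section PCG.
Context {R : realType}.
Variable n : nat.
Implicit Types (A M : 'M[R]_n) (x y : 'cV[R]_n).

Definition krylov A M y (t : nat) : set 'cV[R]_n :=
  [set x | exists a : 'I_t -> R,
     x = \sum_(j < t) a j *: ((invmx M *m A) ^+ j *m (invmx M *m y))].

(* [xget 0] is a definite description: for A, M positive definite there is
   exactly one minimizer. For t = 0 the Krylov space is {0}. *)
Definition pcg_iterate A M y (t : nat) : 'cV[R]_n :=
  let c := invmx A *m y in
  xget 0 [set x | krylov A M y t x /\
            forall z, krylov A M y t z -> normA A (x - c) <= normA A (z - c)].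

End PCG.

(* a nonpositive ceiling means that no iteration is performed *)
Definition pcg_steps (R : realType) (eps : R) : nat :=
  absz (Num.max 0 (Num.ceil (Num.sqrt 3 / 2 * ln (2 / eps)))).

Section Kernel.
Context {R : realType}.

Definition poly_kernel n d (q : nat) (x : 'I_n -> 'cV[R]_d) : 'M[R]_n :=
  \matrix_(i, j) ((x i)^T *m x j) 0 0 ^+ q.

Definition stat_dim n (lambda : R) (K : 'M[R]_n) : R :=
  \tr (invmx (K + lambda%:M) *m K).

End Kernel.

Section TensorSketch.
Context {R : realType}.
Variables (d q s : nat).

(* Coordinates of R^(d^q) are indexed by [d]^q = {ffun 'I_q -> 'I_d} through
   its enumeration [enum_val]. *)
Definition tensor_index : finType := {ffun 'I_q -> 'I_d}.

(* [s] is represented by 'I_s = {0, ..., s-1}, i.e. by the residues mod s, and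
   the sign +1 (resp. -1) by false (resp. true). *)
Definition tensor_hash (h : 'I_q -> {ffun 'I_d -> 'I_s}) (i : tensor_index) :
  nat := ((\sum_(k < q) h k (i k)) %% s)%N.

Definition tensor_sign (g : 'I_q -> {ffun 'I_d -> bool}) (i : tensor_index) :
  R := \prod_(k < q) (-1) ^+ g k (i k).

Definition tensor_sketch_mx (h : 'I_q -> {ffun 'I_d -> 'I_s})
    (g : 'I_q -> {ffun 'I_d -> bool}) : 'M[R]_(s, #|tensor_index|) :=
  \matrix_(j, c)
    (if j == tensor_hash h (enum_val c) :> nat
     then tensor_sign g (enum_val c) else 0).

Definition tensor_power (x : 'cV[R]_d) : 'cV[R]_#|tensor_index| :=
  \col_c \prod_(k < q) x ((enum_val c : tensor_index) k) 0.

Definition tensor_sketch h g (x : 'cV[R]_d) : 'cV[R]_s :=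
  tensor_sketch_mx h g *m tensor_power x.

Definition sketched_rows n (x : 'I_n -> 'cV[R]_d) h g : 'M[R]_(n, s) :=
  \matrix_(i, j) tensor_sketch h g (x i) j 0.

End TensorSketch.

Section Randomness.
Context {R : realType} {dsp : measure_display} {Omega : measurableType dsp}.
Variable Pr : probability Omega R.

(* Mutual independence of the classes of events E i, i : I. *)
Definition mutually_independent (I : finType) (E : I -> set (set Omega)) :=
  forall (J : {set I}) (A : I -> set Omega), (forall i, i \in J -> E i (A i)) ->
    Pr (\bigcap_(i in [set` J]) A i) = (\prod_(i in J) Pr (A i))%E.

Definition random_function (A B : finType) (f : Omega -> {ffun A -> B}) :=
  forall v : {ffun A -> B}, measurable (f @^-1` [set v]).

(* The values at any (at most k) distinct points are independent and uniform.
   Allowing fewer than k points matters only when #|A| < k. *)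
Definition kwise_uniform (k : nat) (A B : finType)
    (f : Omega -> {ffun A -> B}) :=
  forall (S : {set A}) (v : A -> B), (#|S| <= k)%N ->
    Pr [set w | forall a, a \in S -> f w a = v a] = ((#|B|%:R ^- #|S|)%:E)%E.

Definition events_of (T : Type) (f : Omega -> T) : set (set Omega) :=
  [set f @^-1` B | B in setT].

Definition tensor_sketch_randomness (d q s : nat)
    (h : 'I_q -> Omega -> {ffun 'I_d -> 'I_s})
    (g : 'I_q -> Omega -> {ffun 'I_d -> bool}) : Prop :=
  [/\ forall k, random_function (h k) /\ random_function (g k),
      forall k, kwise_uniform 3 (h k),
      forall k, kwise_uniform 4 (g k) &
      mutually_independent (fun k : 'I_q + 'I_q =>
        match k with
        | inl k => events_of (h k)
        | inr k => events_of (g k)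
        end)].

End Randomness.

Section Conditions.
Context {R : realType}.
Variables (n s m : nat) (lambda : R).

Definition sketch_proj (Z : 'M[R]_(n, s)) : 'M[R]_n :=
  orthproj (eigenspan_gt (Z *m Z^T) (5 / 100 * lambda)).

Definition condition1 (K : 'M[R]_n) (Z : 'M[R]_(n, s)) : Prop :=
  let P := sketch_proj Z in
  spectral_norm ((1%:M - P) *m K *m (1%:M - P)) <= 1 / 10 * lambda.

Definition condition2 (V : 'M[R]_(n, m)) (Z : 'M[R]_(n, s)) : Prop :=
  let P := sketch_proj Z in
  forall x : 'cV[R]_n,
    9 / 10 * norm2 (Z^T *m P *m x) ^+ 2 <= norm2 (V^T *m P *m x) ^+ 2
      <= 11 / 10 * norm2 (Z^T *m P *m x) ^+ 2.

End Conditions.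

(* Main.v *)
Require Import Defs.
From mathcomp Require Import all_boot all_order all_algebra.
From mathcomp Require Import all_classical all_reals all_analysis.
From mathcomp Require Import polyrcf complex ring lra.

(** Write [A = K + lambda], [M = Z Z^T + lambda].

    Deterministic part. Under the two conditions, splitting a vector along [P]
    gives [A <= (3/2) M] and [M <= 2 A] as quadratic forms
    ([preconditioner_equiv]), hence a condition number at most 3. The operator
    [B = M^-1 A] is self-adjoint for the inner product of [A], with numerical
    range in [1/2, 3/2]. The Krylov space contains [c - p(B) c / p(0)] for all
    polynomials [p] of degree at most [t] ([krylov_poly]); take
    [p(z) = T_t(2 - 2 z)] with [T_t] the Chebyshev polynomial. The Pell equation
    [T_t^2 + (1 - X^2) U_t^2 = 1], evaluated at [X = 2 - 2 B], shows that [p(B)]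
    is a contraction, because [1 - X^2] is positive; there is no need to diagonalize [B].
    At [X = 2], with the recurrence, it gives [2 T_t(2) >= (2 + sqrt 3)^t], and
    [2 + sqrt 3 >= exp (2 / sqrt 3)], so that the error factor [1 / T_t(2)] is
    at most [eps] after the prescribed number of steps ([pcg_bound]).

    Probabilistic part. If the quadratic forms of [Z Z^T] and [K] differ by at
    most [1/250] times that of [A], both conditions hold
    ([conditions_of_approx]). Let [A = L L^T], let [Phi] be the matrix of
    tensor powers, so that [K = Phi Phi^T] and [Z = Phi S^T], and put
    [W = L^-1 Phi]; its squared Frobenius norm is the statistical dimension
    ([whitening]). It then suffices that the Frobenius norm of
    [W S^T S W^T - W W^T] be at most [1/250], and by Markov's inequality this
    follows from the second moment bound [3^q / s * |W|_F^4]
    ([sketch_frob_moment]). An entry of this matrix is a sum over pairs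
    [(I, J)] of distinct multi-indices; its square is a sum over quadruples
    [(I, J, K, L)]. The hash functions contribute at most the collision
    probability [1 / s] ([tensor_collision]). The signs contribute a factor
    that vanishes unless, in each coordinate, the four entries of
    [I, J, K, L] match in pairs ([sign_four_point]). There are three ways to
    match four entries, and summing out one coordinate after the other with
    the Cauchy-Schwarz inequality costs a factor 3 for each ([four_point]). *)

Set Implicit Arguments.
Unset Strict Implicit.
Unset Printing Implicit Defensive.

Import Order.TTheory GRing.Theory Num.Theory.
Local Open Scope classical_set_scope.
Local Open Scope ring_scope.

(** * Euclidean inner product *)

Section InnerProduct.
Context {R : realType}.

Definition dotc n (u v : 'cV[R]_n) : R := (u^T *m v) 0 0.

Lemma dotcE n (u v : 'cV[R]_n) : dotc u v = \sum_i u i 0 * v i 0.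
Proof. by rewrite /dotc mxE; apply: eq_bigr => i _; rewrite mxE. Qed.

Lemma dotcC n (u v : 'cV[R]_n) : dotc u v = dotc v u.
Proof. by rewrite !dotcE; apply: eq_bigr => i _; rewrite mulrC. Qed.

Lemma dotcDr n (u v w : 'cV[R]_n) : dotc u (v + w) = dotc u v + dotc u w.
Proof. by rewrite /dotc mulmxDr mxE. Qed.

Lemma dotcDl n (u v w : 'cV[R]_n) : dotc (v + w) u = dotc v u + dotc w u.
Proof. by rewrite dotcC dotcDr !(dotcC u). Qed.

Lemma dotcZr n a (u v : 'cV[R]_n) : dotc u (a *: v) = a * dotc u v.
Proof. by rewrite /dotc -scalemxAr mxE. Qed.

Lemma dotcZl n a (u v : 'cV[R]_n) : dotc (a *: u) v = a * dotc u v.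
Proof. by rewrite dotcC dotcZr dotcC. Qed.

Lemma dotcNr n (u v : 'cV[R]_n) : dotc u (- v) = - dotc u v.
Proof. by rewrite -scaleN1r dotcZr mulN1r. Qed.

Lemma dotcNl n (u v : 'cV[R]_n) : dotc (- u) v = - dotc u v.
Proof. by rewrite dotcC dotcNr dotcC. Qed.

Lemma dotc0r n (u : 'cV[R]_n) : dotc u 0 = 0.
Proof. by rewrite /dotc mulmx0 mxE. Qed.

Lemma dotc_mulmxl m n (A : 'M[R]_(m, n)) u v :
  dotc (A *m u) v = dotc u (A^T *m v).
Proof. by rewrite /dotc trmx_mul mulmxA. Qed.

Lemma dotc_ge0 n (u : 'cV[R]_n) : 0 <= dotc u u.
Proof. by rewrite dotcE sumr_ge0 // => i _; rewrite -expr2 sqr_ge0. Qed.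

Lemma dotc_eq0 n (u : 'cV[R]_n) : dotc u u = 0 -> u = 0.
Proof.
rewrite dotcE => /eqP; rewrite psumr_eq0; last first.
  by move=> i _; rewrite -expr2 sqr_ge0.
move/allP => u0; apply/colP => i; rewrite mxE.
by have := u0 i (mem_index_enum _); rewrite mulf_eq0 orbb => /eqP.
Qed.

Lemma norm2E n (u : 'cV[R]_n) : norm2 u = Num.sqrt (dotc u u).
Proof. by rewrite dotcE; congr Num.sqrt; apply: eq_bigr => i _; rewrite expr2. Qed.

Lemma norm2_sqr n (u : 'cV[R]_n) : norm2 u ^+ 2 = dotc u u.
Proof. by rewrite norm2E sqr_sqrtr // dotc_ge0. Qed.

Lemma normAE n (A : 'M[R]_n) (u : 'cV[R]_n) :
  normA A u = Num.sqrt (dotc u (A *m u)).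
Proof. by rewrite /normA /dotc mulmxA. Qed.

Lemma CauchySchwarz_dotc n (u v : 'cV[R]_n) :
  dotc u v ^+ 2 <= dotc u u * dotc v v.
Proof.
have [/dotc_eq0 ->|v_neq0] := eqVneq (dotc v v) 0.
  by rewrite !dotc0r expr2 !mulr0.
have v_gt0 : 0 < dotc v v by rewrite lt0r v_neq0 dotc_ge0.
have := dotc_ge0 (u - (dotc u v / dotc v v) *: v).
rewrite !(dotcDl, dotcDr, dotcNl, dotcNr, dotcZl, dotcZr) (dotcC v u).
rewrite [X in 0 <= X](_ : _ = (dotc u u * dotc v v - dotc u v ^+ 2) / dotc v v).
  by rewrite pmulr_lge0 ?invr_gt0 // subr_ge0.
by field.
Qed.

End InnerProduct.

(** * Spectral theorem for real symmetric matrices *)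

Section Spectral.
Context {R : realType}.

(** A symmetric matrix is Hermitian over the complex numbers, hence
    unitarily diagonalizable with real eigenvalues. *)
Lemma symmetric_eigenvalue n (A : 'M[R]_n.+1) : A^T = A ->
  exists a, eigenvalue A a.
Proof.
move=> symA.
pose f : {rmorphism R -> R[i]} := real_complex R.
pose B := map_mx f A.
have hB : B \is hermsymmx.
  apply: realsym_hermsym.
    by apply/is_hermitianmxP; rewrite expr0 scale1r map_mx_id // /B map_trmx symA.
  by apply/mxOverP => i j; rewrite mxE /f /=; apply/complex_realP; exists (A i j).
have /mxOverP/(_ 0 0)/complex_realP[a ea] := hermitian_spectral_diag_real hB.
exists a; rewrite eigenvalue_root_char -(fmorph_root f) map_char_poly.
rewrite -eigenvalue_root_char -/B.
have /orthomx_spectralP eB := hermitian_normalmx hB.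
apply/eigenvalueP; exists (row 0 (spectralmx B)).
  rewrite -row_mul {2}eB !mulmxA mulmxV ?spectral_unit // mul1mx.
  by rewrite row_mul row_diag_mx -scalemxAl -rowE ea.
apply: contraTneq (spectral_unitarymx B) => r0.
apply/unitarymxP => /matrixP/(_ 0 0) E.
have := E; rewrite mxE big1 => [|j _].
  by rewrite mxE eqxx => /eqP; rewrite eq_sym oner_eq0.
by move/rowP/(_ j): r0; rewrite !mxE => ->; rewrite mul0r.
Qed.

Lemma symmetric_unit_eigenvector n (A : 'M[R]_n.+1) : A^T = A ->
  exists (a : R) (v : 'cV[R]_n.+1), dotc v v = 1 /\ A *m v = a *: v.
Proof.
move=> symA; have [a /eigenvalueP [u eu u_neq0]] := symmetric_eigenvalue symA.
have Au : A *m u^T = a *: u^T by rewrite -{1}symA -trmx_mul eu linearZ.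
have uu_gt0 : 0 < dotc u^T u^T.
  rewrite lt0r dotc_ge0 andbT; apply: contraNneq u_neq0 => /dotc_eq0 u0.
  by rewrite -[u]trmxK u0 trmx0.
exists a, ((Num.sqrt (dotc u^T u^T))^-1 *: u^T); split.
  rewrite dotcZl dotcZr mulrA -invfM -expr2 sqr_sqrtr ?ltW //.
  by rewrite mulVf // gt_eqF.
by rewrite -scalemxAr Au !scalerA mulrC.
Qed.

(** The reflection in the hyperplane orthogonal to [e0 - v] exchanges the unit
    vectors [e0] and [v]. It supplies an orthogonal matrix with prescribed
    first column without an orthonormalization procedure. *)
Lemma householder n (v : 'cV[R]_n.+1) : dotc v v = 1 ->
  exists Q : 'M[R]_n.+1,
    [/\ Q^T = Q, Q *m Q = 1%:M & Q *m delta_mx 0 0 = v].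
Proof.
move=> vv; pose e : 'cV[R]_n.+1 := delta_mx 0 0.
have ee : dotc e e = 1.
  rewrite dotcE (bigD1 0) //= !mxE eqxx mulr1 big1 ?addr0 // => i /negPf i0.
  by rewrite !mxE i0 mul0r.
pose w := e - v; pose t := dotc w w.
have tE : t = 2 - 2 * dotc v e.
  rewrite /t /w !(dotcDl, dotcDr, dotcNl, dotcNr) ee vv (dotcC e); ring.
have we : dotc w e = t / 2 by rewrite tE /w dotcDl dotcNl ee; field.
have wwE (u : 'cV_n.+1) : w *m w^T *m u = dotc w u *: w.
  by rewrite -mulmxA [_ *m u]mx11_scalar mul_mx_scalar.
have [t0|t_neq0] := eqVneq t 0.
  exists 1%:M; rewrite trmx1 !mul1mx; split=> //.
  by apply/eqP; rewrite -subr_eq0; apply/eqP/dotc_eq0.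
have ww : w *m w^T *m (w *m w^T) = t *: (w *m w^T).
  by rewrite mulmxA wwE -/t scalemxAl.
exists (1%:M - (2 / t) *: (w *m w^T)); split.
- by rewrite linearB linearZ /= trmx1 trmx_mul trmxK.
- rewrite mulmxBl !mulmxBr !mul1mx mulmx1 -!scalemxAl -scalemxAr ww.
  move: (w *m w^T) => P; apply/matrixP => i j; rewrite !mxE; field.
  exact: t_neq0.
- rewrite mulmxBl mul1mx -scalemxAl wwE we scalerA.
  rewrite (_ : 2 / t * (t / 2) = 1) ?scale1r; last by field.
  by rewrite /w opprB addrC subrK.
Qed.

(** Conjugating by a reflection that sends the first basis vector to an
    eigenvector splits off a 1 x 1 block; by symmetry the matrix becomes block
    diagonal. *)
Theorem real_spectral n (A : 'M[R]_n) : A^T = A ->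
  exists (U : 'M[R]_n) (D : 'rV[R]_n),
    U^T *m U = 1%:M /\ A = U *m diag_mx D *m U^T.
Proof.
elim: n A => [|n IHn] A symA.
  by exists 0, 0; split; apply/matrixP => [[]].
have [a [v [vv Av]]] := symmetric_unit_eigenvector symA.
have [Q [symQ QQ Qe]] := householder vv.
have [B BE] : exists B : 'M[R]_(1 + n), B = Q *m A *m Q by exists (Q *m A *m Q).
have symB : B^T = B by rewrite BE !trmx_mul symQ symA mulmxA.
have Be : B *m delta_mx 0 0 = a *: (delta_mx 0 0 : 'cV_(1 + n)).
  by rewrite BE -!mulmxA Qe Av -scalemxAr -Qe mulmxA QQ mul1mx.
have Bcol i : B i 0 = a * (i == 0)%:R.
  have /colP/(_ i) := Be; rewrite -colE !mxE => ->; by rewrite andbT.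
have Brow j : B 0 j = a * (j == 0)%:R by rewrite -Bcol -{1}symB [LHS]mxE.
have lsh0 : lshift n 0 = 0 :> 'I_(1 + n) by apply: val_inj.
have rshN i : (rshift 1 i == 0 :> 'I_(1 + n)) = false by [].
have Bdl : dlsubmx B = 0.
  by apply/matrixP => i j'; rewrite ord1 !mxE lsh0 Bcol rshN mulr0.
have Bur : ursubmx B = 0.
  by apply/rowP => j; rewrite !mxE lsh0 Brow rshN mulr0.
have Bul : ulsubmx B = a%:M.
  by rewrite [ulsubmx B]mx11_scalar !mxE lsh0 Bcol eqxx mulr1.
have [|U' [D' [U'U defB']]] := IHn (drsubmx B).
  by rewrite trmx_drsub symB.
pose W : 'M[R]_(1 + n) := block_mx 1%:M 0 0 U'.
have WW : W^T *m W = 1%:M.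
  rewrite /W tr_block_mx !trmx0 trmx1 mulmx_block.
  by rewrite !mulmx0 !mul0mx mulmx1 U'U !addr0 add0r -scalar_mx_block.
have defB : B = W *m diag_mx (row_mx a%:M D') *m W^T.
  rewrite -[B]submxK Bdl Bur Bul defB' diag_mx_row /W tr_block_mx !mulmx_block.
  rewrite !trmx0 trmx1 !mulmx0 !mul0mx !mulmx1 !mul1mx !addr0 !add0r ?mulmx0 ?mul0mx.
  congr block_mx; by apply/matrixP => i j; rewrite !ord1 !mxE.
exists (Q *m W), (row_mx a%:M D'); split.
  by rewrite trmx_mul symQ mulmxA -(mulmxA W^T Q Q) QQ mulmx1 WW.
have -> : A = Q *m B *m Q by rewrite BE !mulmxA QQ mul1mx -mulmxA QQ mulmx1.
by rewrite trmx_mul symQ defB !mulmxA.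
Qed.

Section Consequences.
Variables (n : nat) (A U : 'M[R]_n) (D : 'rV[R]_n).
Hypotheses (UU : U^T *m U = 1%:M) (defA : A = U *m diag_mx D *m U^T).

Lemma spectral_quad (u v : 'cV[R]_n) :
  dotc u (A *m v) = \sum_i D 0 i * (U^T *m u) i 0 * (U^T *m v) i 0.
Proof.
have -> : dotc u (A *m v) = dotc (U^T *m u) (diag_mx D *m (U^T *m v)).
  by rewrite defA dotc_mulmxl trmxK !mulmxA.
rewrite dotcE; apply: eq_bigr => i _.
by rewrite mul_diag_mx [X in _ * X]mxE mulrCA mulrA.
Qed.

Lemma spectral_dotc (u v : 'cV[R]_n) :
  dotc u v = \sum_i (U^T *m u) i 0 * (U^T *m v) i 0.
Proof. by rewrite -dotcE dotc_mulmxl trmxK mulmxA (mulmx1C UU) mul1mx. Qed.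

Lemma spectral_mulUA : U^T *m A = diag_mx D *m U^T.
Proof. by rewrite defA !mulmxA UU mul1mx. Qed.

End Consequences.

(** With [A = U D U^T], take [L = U sqrt(D)]. *)
Lemma posdef_factor n (A : 'M[R]_n) : A^T = A ->
  (forall u : 'cV[R]_n, u != 0 -> 0 < dotc u (A *m u)) ->
  exists2 L : 'M[R]_n, L \in unitmx & A = L *m L^T.
Proof.
move=> symA posA; have [U [D [UU defA]]] := real_spectral symA.
have Upos i : 0 < D 0 i.
  have := posA (col i U); rewrite (spectral_quad defA) => H.
  have Ui : U^T *m col i U = delta_mx i 0.
    by rewrite colE mulmxA UU mul1mx.
  move: H; rewrite Ui (bigD1 i) //= big1 => [|j /negPf ji]; last first.
    by rewrite mxE ji mulr0.
  rewrite mxE !eqxx !mulr1 addr0; apply.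
  apply/eqP => c0; move: Ui; rewrite c0 mulmx0 => /colP/(_ i).
  by rewrite !mxE !eqxx => /eqP; rewrite eq_sym oner_eq0.
pose S := map_mx Num.sqrt D.
exists (U *m diag_mx S).
  rewrite unitmx_mul (mulmx1_unit UU).2 unitmxE det_diag unitfE.
  by apply/prodf_neq0 => i _; rewrite mxE gt_eqF // sqrtr_gt0.
rewrite defA trmx_mul tr_diag_mx !mulmxA; congr (_ *m _); rewrite -mulmxA.
congr (_ *m _); apply/matrixP => i j.
rewrite mul_diag_mx !mxE mulrnAr; congr (_ *+ _).
by rewrite -expr2 sqr_sqrtr // ltW.
Qed.

End Spectral.

(** * Orthogonal projections and eigenspaces *)

Section Projection.
Context {R : realType}.

Lemma spectral_row n (A U : 'M[R]_n) D (UU : U^T *m U = 1%:M)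
    (defA : A = U *m diag_mx D *m U^T) i :
  row i U^T *m A = D 0 i *: row i U^T.
Proof.
by rewrite -row_mul (spectral_mulUA UU defA) row_mul row_diag_mx -scalemxAl -rowE.
Qed.

Section Orthproj.
Variables (n : nat) (U : 'M[R]_n).
Let P := orthproj U.

Lemma capmx_ker_tr : (U :&: kermx U^T = 0)%MS.
Proof.
apply/eqP; rewrite -submx0; apply/rV_subP => w.
rewrite sub_capmx => /andP[/submxP[a wE] /sub_kermxP wU].
have /dotc_eq0 w0 : dotc w^T w^T = 0.
  by rewrite /dotc trmxK {1}wE -mulmxA -[U]trmxK -trmx_mul wU trmx0 mulmx0 mxE.
by rewrite -[w]trmxK w0 trmx0 sub0mx.
Qed.

(** By a dimension count: over the reals, the row space of [U] meets its
    orthogonal complement trivially. *)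
Lemma addsmx_ker_tr : (1%:M <= U + kermx U^T)%MS.
Proof.
rewrite sub1mx /row_full (mxrank_disjoint_sum capmx_ker_tr).
by rewrite mxrank_ker mxrank_tr subnKC // rank_leq_row.
Qed.

Lemma orthproj_sub : (P <= U)%MS.
Proof. by rewrite -[P]mul1mx proj_mx_sub. Qed.

Lemma orthproj_compl_mul : (1%:M - P) *m U^T = 0.
Proof.
apply/sub_kermxP; rewrite -[P]mul1mx proj_mx_compl_sub //.
exact: addsmx_ker_tr.
Qed.

(** Taking [W = P] gives the symmetry of [P]; taking [W = P A] gives its
    commutation with a symmetric matrix [A] that stabilizes [U]. *)
Lemma orthproj_compl_orth m (W : 'M[R]_(m, n)) :
  (W <= U)%MS -> W *m (1%:M - P)^T = 0.
Proof.
move=> /submxP[X ->]; rewrite -mulmxA -[U]trmxK -trmx_mul orthproj_compl_mul.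
by rewrite trmx0 mulmx0.
Qed.

Lemma orthproj_mul_tr : P = P *m P^T.
Proof.
have := orthproj_compl_orth orthproj_sub.
by rewrite linearB /= trmx1 mulmxBr mulmx1 => /eqP; rewrite subr_eq0 => /eqP.
Qed.

Lemma orthproj_sym : P^T = P.
Proof. by rewrite orthproj_mul_tr trmx_mul trmxK. Qed.

Lemma orthproj_idem : P *m P = P.
Proof. by rewrite -{2}orthproj_sym -orthproj_mul_tr. Qed.

End Orthproj.

Section Eigenspan.
Variables (n : nat) (A : 'M[R]_n) (t : R).
Hypothesis symA : A^T = A.
Let S := eigenspan_gt A t.
Let P := orthproj S.

Lemma eigenspace_sub_eigenspan (a : R) m (W : 'M[R]_(m, n)) :
  W *m A = a *: W -> t < a -> (W <= S)%MS.
Proof.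
move=> WA ta; have [->|W_neq0] := eqVneq W 0; first exact: sub0mx.
have a_root : a \in rootsR (char_poly A).
  rewrite -roots_on_rootsR ?monic_neq0 ?char_poly_monic // inE /=.
  rewrite -eigenvalue_root_char.
  apply: contraNneq W_neq0 => E0.
  by rewrite -submx0 -E0; apply/eigenspaceP.
rewrite /S /eigenspan_gt (big_rem a) //= ta.
by apply: submx_trans (addsmxSl _ _); apply/eigenspaceP.
Qed.

Lemma eigenspan_gtP m (W : 'M[R]_(n, m)) :
  (forall a, t < a -> eigenspace A a *m W = 0) -> S *m W = 0.
Proof.
move=> H; apply/sub_kermxP; rewrite /S /eigenspan_gt.
apply: (big_ind (fun M : 'M[R]_n => (M <= kermx W)%MS)).
- exact: sub0mx.
- by move=> M N sM sN; rewrite addsmx_sub sM.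
- by move=> a ta; apply/sub_kermxP/H.
Qed.

Lemma eigenspan_stable : (S *m A <= S)%MS.
Proof.
rewrite /S /eigenspan_gt.
apply: (big_ind (fun M : 'M[R]_n => (M *m A <= M)%MS)).
- by rewrite mul0mx sub0mx.
- by move=> M N sM sN; rewrite addsmxMr addsmxS.
- move=> a _; move/eigenspaceP: (submx_refl (eigenspace A a)) => ->.
  exact: scalemx_sub.
Qed.

(** The span of eigenspaces is stable under [A], and so is its orthogonal
    complement because [A] is symmetric. *)
Lemma eigenproj_comm : A *m P = P *m A.
Proof.
have H : P *m A = P *m A *m P.
  have : (P *m A <= S)%MS.
    by apply: submx_trans eigenspan_stable; rewrite submxMr ?orthproj_sub.
  move=> /orthproj_compl_orth; rewrite -/P linearB /= trmx1 orthproj_sym.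
  by rewrite mulmxBr mulmx1 => /eqP; rewrite subr_eq0 => /eqP.
have PT : P^T = P := orthproj_sym S.
have HT : A *m P = P *m A *m P.
  have := congr1 trmx H.
  by rewrite (trmx_mul P A) (trmx_mul _ P) (trmx_mul P A) symA PT mulmxA.
by rewrite HT -H.
Qed.

(** The range of [P] is orthogonal to the eigenvectors with eigenvalue at most
    [t], so only the larger eigenvalues contribute to the quadratic form. *)
Lemma eigenproj_ge (x : 'cV[R]_n) :
  t * dotc (P *m x) (P *m x) <= dotc (P *m x) (A *m (P *m x)).
Proof.
have [U [D [UU defA]]] := real_spectral symA.
rewrite (spectral_quad defA) (spectral_dotc UU) mulr_sumr.
apply: ler_sum => i _; rewrite -mulrA.
have [tD|Dt] := ltP t (D 0 i).
  by rewrite ler_wpM2r ?(ltW tD) // -expr2 sqr_ge0.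
suff -> : (U^T *m (P *m x)) i 0 = 0 by rewrite !mulr0.
have r_eigen := spectral_row UU defA i.
set r := row i U^T in r_eigen.
have Sr : S *m r^T = 0.
  apply: eigenspan_gtP => a ta; set E := eigenspace A a.
  have EA : E *m A = a *: E by apply/eigenspaceP.
  have Ar : A *m r^T = D 0 i *: r^T by rewrite -{1}symA -trmx_mul r_eigen linearZ.
  have : (a - D 0 i) *: (E *m r^T) = 0.
    by rewrite scalerBl scalemxAl -EA -mulmxA Ar -scalemxAr subrr.
  move=> /eqP; rewrite scaler_eq0 subr_eq0 gt_eqF ?(le_lt_trans Dt ta) //=.
  by move/eqP.
have Pr : P *m r^T = 0.
  have /submxP[X ->] : (P <= S)%MS := orthproj_sub S.
  by rewrite -mulmxA Sr mulmx0.
have -> : (U^T *m (P *m x)) i 0 = (r *m (P *m x)) 0 0 by rewrite -row_mul [RHS]mxE.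
by rewrite mulmxA -[r *m P]trmxK trmx_mul orthproj_sym Pr trmx0 mul0mx mxE.
Qed.

(** Dually, a vector killed by [P] is orthogonal to the eigenvectors with
    eigenvalue greater than [t]. *)
Lemma eigenproj_compl_le (v : 'cV[R]_n) : P *m v = 0 ->
  dotc v (A *m v) <= t * dotc v v.
Proof.
move=> Pv; have [U [D [UU defA]]] := real_spectral symA.
rewrite (spectral_quad defA) (spectral_dotc UU) mulr_sumr.
apply: ler_sum => i _; rewrite -mulrA.
have [tD|Dt] := ltP t (D 0 i); last first.
  by rewrite ler_wpM2r // -expr2 sqr_ge0.
suff -> : (U^T *m v) i 0 = 0 by rewrite !mulr0.
have rS := eigenspace_sub_eigenspan (spectral_row UU defA i) tD.
have -> : (U^T *m v) i 0 = (row i U^T *m v) 0 0 by rewrite -row_mul [RHS]mxE.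
have := orthproj_compl_orth rS; rewrite -/P linearB /= trmx1 orthproj_sym.
rewrite mulmxBr mulmx1 => /eqP; rewrite subr_eq0 => /eqP ->.
by rewrite -mulmxA Pv mulmx0 mxE.
Qed.

End Eigenspan.
End Projection.

(** * Spectral norm and Frobenius norm *)

Section MatrixNorms.
Context {R : realType}.

Definition frob2 m n (A : 'M[R]_(m, n)) : R := \sum_i \sum_j A i j ^+ 2.

Lemma frob2_ge0 m n (A : 'M[R]_(m, n)) : 0 <= frob2 A.
Proof. by do 2![apply: sumr_ge0 => ? _]; exact: sqr_ge0. Qed.

(** The Cauchy-Schwarz inequality, row by row. *)
Lemma dotc_mulmx_le m n (A : 'M[R]_(m, n)) (u : 'cV[R]_n) :
  dotc (A *m u) (A *m u) <= frob2 A * dotc u u.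
Proof.
rewrite dotcE /frob2 mulr_suml; apply: ler_sum => i _.
have -> : (A *m u) i 0 = dotc (row i A)^T u by rewrite /dotc trmxK -row_mul [RHS]mxE.
rewrite -expr2; apply: le_trans (CauchySchwarz_dotc _ _) _.
rewrite ler_wpM2r ?dotc_ge0 // dotcE.
by apply: ler_sum => j _; rewrite !mxE expr2.
Qed.

Lemma norm2_ge0 n (u : 'cV[R]_n) : 0 <= norm2 u.
Proof. exact: sqrtr_ge0. Qed.

Lemma norm2_le n p (u : 'cV[R]_n) (v : 'cV[R]_p) c : 0 <= c ->
  dotc u u <= c ^+ 2 * dotc v v -> norm2 u <= c * norm2 v.
Proof.
move=> c0 H; rewrite -(@ler_pXn2r _ 2) ?nnegrE ?mulr_ge0 ?norm2_ge0 //.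
by rewrite exprMn !norm2_sqr.
Qed.

Lemma spectral_norm_le m n (A : 'M[R]_(m, n)) c : 0 <= c ->
  (forall u, norm2 (A *m u) <= c * norm2 u) -> spectral_norm A <= c.
Proof.
move=> c0 H; apply: ge_sup.
  exists (norm2 (A *m 0)); exists 0 => //=.
  by rewrite norm2E dotc0r sqrtr0 ler01.
move=> _ [u /= u1 <-]; apply: le_trans (H u) _.
by rewrite -[leRHS]mulr1 ler_wpM2l.
Qed.

(** The supremum that defines the spectral norm is finite because the Frobenius
    norm is a bound; homogeneity does the rest. *)
Lemma norm2_mulmx_le m n (A : 'M[R]_(m, n)) u :
  norm2 (A *m u) <= spectral_norm A * norm2 u.
Proof.
set E := [set norm2 (A *m x) | x in [set x : 'cV[R]_n | norm2 x <= 1]].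
have Ebound : has_ubound E.
  exists (Num.sqrt (frob2 A)) => _ [x /= x1 <-].
  apply: (@le_trans _ _ (Num.sqrt (frob2 A) * norm2 x)).
    by apply: norm2_le; rewrite ?sqrtr_ge0 // sqr_sqrtr ?frob2_ge0 // dotc_mulmx_le.
  by rewrite -[leRHS]mulr1 ler_wpM2l // sqrtr_ge0.
have [u0|u_neq0] := eqVneq (norm2 u) 0.
  have /dotc_eq0 -> : dotc u u = 0 by rewrite -norm2_sqr u0 expr2 mulr0.
  by rewrite mulmx0 !norm2E !dotc0r sqrtr0 mulr0.
have u_gt0 : 0 < norm2 u by rewrite lt0r u_neq0 norm2_ge0.
have norm2Z p a (w : 'cV[R]_p) : 0 <= a -> norm2 (a *: w) = a * norm2 w.
  move=> a0; rewrite !norm2E dotcZl dotcZr mulrA -expr2 sqrtrM ?sqr_ge0 //.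
  by rewrite sqrtr_sqr ger0_norm.
have : E (norm2 (A *m ((norm2 u)^-1 *: u))).
  exists ((norm2 u)^-1 *: u) => //=.
  by rewrite norm2Z ?invr_ge0 ?norm2_ge0 // mulVf.
move=> /(ub_le_sup Ebound); rewrite -scalemxAr norm2Z ?invr_ge0 ?norm2_ge0 //.
by rewrite mulrC ler_pdivrMr.
Qed.

Lemma dotc_spectral_norm n (A : 'M[R]_n) u :
  dotc u (A *m u) <= spectral_norm A * dotc u u.
Proof.
have [|Apos] := leP (dotc u (A *m u)) 0.
  move=> /le_trans; apply; rewrite -norm2_sqr expr2 mulrA mulr_ge0 ?norm2_ge0 //.
  exact: le_trans (norm2_ge0 _) (norm2_mulmx_le A u).
apply: (@le_trans _ _ (norm2 u * norm2 (A *m u))).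
  rewrite -(@ler_pXn2r _ 2) ?nnegrE ?mulr_ge0 ?norm2_ge0 ?(ltW Apos) //.
  by rewrite exprMn !norm2_sqr CauchySchwarz_dotc.
by rewrite -norm2_sqr expr2 mulrA mulrC ler_wpM2r ?norm2_ge0 // norm2_mulmx_le.
Qed.

Lemma dotc_frob n (A : 'M[R]_n) u c : 0 <= c -> frob2 A <= c ^+ 2 ->
  `|dotc u (A *m u)| <= c * dotc u u.
Proof.
move=> c0 Ac; rewrite -(@ler_pXn2r _ 2) ?nnegrE ?mulr_ge0 ?dotc_ge0 //.
rewrite real_normK ?num_real //; apply: le_trans (CauchySchwarz_dotc _ _) _.
rewrite exprMn [leLHS]mulrC expr2 mulrA ler_wpM2r ?dotc_ge0 //.
apply: le_trans (dotc_mulmx_le _ _) _; by rewrite ler_wpM2r ?dotc_ge0.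
Qed.

Lemma dotc_gram m n (V : 'M[R]_(n, m)) (u v : 'cV[R]_n) :
  dotc u (V *m V^T *m v) = dotc (V^T *m u) (V^T *m v).
Proof. by rewrite dotc_mulmxl trmxK mulmxA. Qed.

End MatrixNorms.

(** * The two conditions and the preconditioned operator *)

Section Equivalence.
Context {R : realType}.
Variables (n m s : nat) (V : 'M[R]_(n, m)) (Z : 'M[R]_(n, s)) (lambda : R).
Hypothesis lambda_gt0 : 0 < lambda.
Let K := V *m V^T.
Let M := Z *m Z^T.
Let P := sketch_proj lambda Z.

Lemma gram_sym p (W : 'M[R]_(n, p)) : (W *m W^T)^T = W *m W^T.
Proof. by rewrite trmx_mul trmxK. Qed.

Lemma dotc_shift (B : 'M[R]_n) x :
  dotc x ((B + lambda%:M) *m x) = dotc x (B *m x) + lambda * dotc x x.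
Proof. by rewrite mulmxDl dotcDr mul_scalar_mx dotcZr. Qed.

Lemma sketch_proj_sym : P^T = P. Proof. exact: orthproj_sym. Qed.

Lemma sketch_proj_idem : P *m P = P. Proof. exact: orthproj_idem. Qed.

Lemma sketch_proj_comm : M *m P = P *m M.
Proof. by apply: eigenproj_comm; exact: gram_sym. Qed.

Lemma sketch_proj_ge x :
  5 / 100 * lambda * dotc (P *m x) (P *m x) <= dotc (P *m x) (M *m (P *m x)).
Proof. by apply: eigenproj_ge; exact: gram_sym. Qed.

Lemma sketch_proj_le v : P *m v = 0 ->
  dotc v (M *m v) <= 5 / 100 * lambda * dotc v v.
Proof. by apply: eigenproj_compl_le; exact: gram_sym. Qed.

Lemma proj_compl0 (x : 'cV[R]_n) : P *m ((1%:M - P) *m x) = 0.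
Proof. by rewrite mulmxA mulmxBr mulmx1 sketch_proj_idem subrr mul0mx. Qed.

Lemma condition1_quad v : condition1 lambda K Z -> P *m v = 0 ->
  dotc v (K *m v) <= 1 / 10 * lambda * dotc v v.
Proof.
rewrite /condition1 -/P => c1 Pv.
have := le_trans (dotc_spectral_norm _ v) (ler_wpM2r (dotc_ge0 v) c1).
have vE : (1%:M - P) *m v = v by rewrite mulmxBl mul1mx Pv subr0.
have sP : (1%:M - P)^T = 1%:M - P by rewrite linearB /= trmx1 sketch_proj_sym.
rewrite -(mulmxA _ _ v) vE -(mulmxA _ K v).
by rewrite -{1}sP -dotc_mulmxl vE.
Qed.

(** Split [x = u + v] along [P]. The cross term of [Z Z^T] vanishes, since [P]
    commutes with [Z Z^T]; that of [K] is at most [u^T K u / 4 + 4 v^T K v].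
    With these weights, [11/10 * 5/4] and [1 + 5/10] are at most [3/2] for the
    upper bound, while [9/10 * 3/4 * 2] and [2 * (1 - 3/10)] are at least [1]
    and [1 + 5/100] for the lower bound. *)
Lemma preconditioner_equiv (x : 'cV[R]_n) : condition1 lambda K Z -> condition2 lambda V Z ->
  dotc x ((K + lambda%:M) *m x) <= 3 / 2 * dotc x ((M + lambda%:M) *m x) /\
  dotc x ((M + lambda%:M) *m x) <= 2 * dotc x ((K + lambda%:M) *m x).
Proof.
move=> c1 c2; set u := P *m x; pose v := (1%:M - P) *m x.
have xE : x = u + v by rewrite /u /v -mulmxDl addrC subrK mul1mx.
have Pv : P *m v = 0 by exact: proj_compl0.
have Pu : P *m u = u by rewrite /u mulmxA sketch_proj_idem.
have uv : dotc u v = 0 by rewrite -Pu dotc_mulmxl sketch_proj_sym Pv dotc0r.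
have uMv : dotc u (M *m v) = 0.
  rewrite -Pu dotc_mulmxl sketch_proj_sym mulmxA -sketch_proj_comm -mulmxA Pv.
  by rewrite mulmx0 dotc0r.
have kv := condition1_quad c1 Pv.
have mv := sketch_proj_le Pv.
have mv0 : 0 <= dotc v (M *m v) by rewrite dotc_gram dotc_ge0.
have mu0 : 0 <= dotc u (M *m u) by rewrite dotc_gram dotc_ge0.
have := c2 x; rewrite !norm2_sqr -/P
  -(mulmxA Z^T P x) -(mulmxA V^T P x) -/u -!dotc_gram -/K -/M.
move=> /andP[ku1 ku2].
have lu : 0 <= lambda * dotc u u by rewrite mulr_ge0 ?dotc_ge0 // ltW.
have lv : 0 <= lambda * dotc v v by rewrite mulr_ge0 ?dotc_ge0 // ltW.
have cross1 : 0 <= dotc (u + 4 *: v) (K *m (u + 4 *: v)).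
  by rewrite dotc_gram dotc_ge0.
have cross2 : 0 <= dotc (u - 4 *: v) (K *m (u - 4 *: v)).
  by rewrite dotc_gram dotc_ge0.
have symquad (B : 'M[R]_n) : B^T = B -> dotc v (B *m u) = dotc u (B *m v).
  by move=> sB; rewrite dotcC dotc_mulmxl sB.
have vKu := symquad K (gram_sym V); have vMu := symquad M (gram_sym Z).
have vu : dotc v u = 0 by rewrite dotcC.
move: cross1 cross2; rewrite !dotc_shift [in X in _ -> _ -> X]xE.
rewrite !mulmxDr !mulmxN -!scalemxAr.
rewrite !(dotcDl, dotcDr, dotcNl, dotcNr, dotcZl, dotcZr) vKu vMu uv vu uMv.
rewrite !mulrDr => cross1 cross2; split; lra.
Qed.

(** On the range of [P], [lambda |x|^2] is at most [20 x^T Z Z^T x], so a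
    relative error [e] with respect to [K + lambda] is a relative error of about
    [21 e] with respect to [Z Z^T], and [1/250] is small enough. On the
    kernel of [P], [x^T K x] is at most about [(5/100 + e) lambda |x|^2]. *)
Lemma conditions_of_approx :
  (forall x, `|dotc x (M *m x) - dotc x (K *m x)| <=
      1 / 250 * dotc x ((K + lambda%:M) *m x)) ->
  condition1 lambda K Z /\ condition2 lambda V Z.
Proof.
move=> H; split; last first.
  move=> x; have := H (P *m x); have := sketch_proj_ge x.
  rewrite !norm2_sqr -/P -(mulmxA Z^T P x) -(mulmxA V^T P x)
    -!dotc_gram -/K -/M dotc_shift ler_norml.
  set u := P *m x => z0 /andP[H1 H2]; apply/andP; split; lra.
have Kv v : P *m v = 0 -> dotc (V^T *m v) (V^T *m v) <= 1 / 10 * lambda * dotc v v.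
  move=> Pv; have := sketch_proj_le Pv; have := H v.
  have lv : 0 <= lambda * dotc v v by rewrite mulr_ge0 ?dotc_ge0 // ltW.
  rewrite -dotc_gram -/K dotc_shift ler_norml => /andP[H1 H2]; lra.
have sP : (1%:M - P)^T = 1%:M - P by rewrite linearB /= trmx1 sketch_proj_sym.
have l0 : 0 <= 1 / 10 * lambda by rewrite mulr_ge0 ?divr_ge0 // ltW.
apply: spectral_norm_le => // u; apply: norm2_le => //; rewrite -/P.
set w := _ *m u.
pose v := (1%:M - P) *m u.
have wE : w = (1%:M - P) *m (V *m (V^T *m v)) by rewrite /w /v /K !mulmxA.
have Pw : P *m w = 0 by rewrite wE proj_compl0.
have w1 : (1%:M - P) *m w = w by rewrite mulmxBl mul1mx Pw subr0.
(* [|w|^2 = <V^T w, V^T v>], and both factors are controlled by [Kv]. *)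
have ww : dotc w w = dotc (V^T *m w) (V^T *m v).
  by rewrite [X in dotc _ X]wE dotcC dotc_mulmxl sP w1 dotc_mulmxl dotcC.
have vu : dotc v v <= dotc u u.
  have -> : dotc u u = dotc v v + dotc (P *m u) (P *m u).
    have uE : u = v + P *m u by rewrite /v mulmxBl mul1mx subrK.
    have vP : dotc v (P *m u) = 0.
      by rewrite dotcC dotc_mulmxl sketch_proj_sym proj_compl0 dotc0r.
    rewrite {1 2}uE !(dotcDl, dotcDr) vP (dotcC _ v) vP; ring.
  by rewrite lerDl dotc_ge0.
have := CauchySchwarz_dotc (V^T *m w) (V^T *m v); rewrite -ww => CS.
have Kw := Kv w Pw; have Kvv := Kv v (proj_compl0 u).
have w0 := dotc_ge0 w.
have [->|w_neq0] := eqVneq (dotc w w) 0; first by rewrite mulr_ge0 ?sqr_ge0 ?dotc_ge0.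
have w_gt0 : 0 < dotc w w by rewrite lt0r w_neq0.
rewrite -(ler_pM2l w_gt0) -expr2; apply: le_trans CS _.
apply: (@le_trans _ _ (1 / 10 * lambda * dotc w w * (1 / 10 * lambda * dotc v v))).
  by apply: ler_pM; rewrite ?dotc_ge0.
have -> : 1 / 10 * lambda * dotc w w * (1 / 10 * lambda * dotc v v) =
   dotc w w * ((1 / 10 * lambda) ^+ 2 * dotc v v) by ring.
by rewrite ler_pM2l // ler_wpM2l // sqr_ge0.
Qed.

End Equivalence.

(** * Chebyshev polynomials *)

Section Chebyshev.
Context {R : realType}.

(** The pair of the Chebyshev polynomial [T_k] of the first kind and of
    [U_(k-1)] of the second kind. The coupled recurrence makes the Pell equation
    immediate; the index shift gives the starting value [U_(-1) = 0]. *)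
Fixpoint chebyshev (k : nat) : {poly R} * {poly R} :=
  if k is k'.+1 then
    let: (T, U) := chebyshev k' in ('X * T + ('X ^+ 2 - 1) * U, T + 'X * U)
  else (1, 0).

Definition chebT k := (chebyshev k).1.
Definition chebU k := (chebyshev k).2.

Lemma chebTS k : chebT k.+1 = 'X * chebT k + ('X ^+ 2 - 1) * chebU k.
Proof. by rewrite /chebT /chebU /=; case: chebyshev. Qed.

Lemma chebUS k : chebU k.+1 = chebT k + 'X * chebU k.
Proof. by rewrite /chebT /chebU /=; case: chebyshev. Qed.

Lemma cheb_pell k : chebT k ^+ 2 + (1 - 'X ^+ 2) * chebU k ^+ 2 = 1.
Proof.
elim: k => [|k IHk]; first by rewrite /chebT /chebU /= expr1n expr0n mulr0 addr0.
rewrite chebTS chebUS -[RHS]IHk; ring.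
Qed.

(** The recurrence has a factor ['X ^+ 2]; the degree of [T_(k+1)] is read off
    from [T_(k+1) = 'X U_(k+1) - U_k] instead, which is why the three sizes
    are bounded together. *)
Lemma size_cheb k :
  [/\ (size (chebT k) <= k.+1)%N, (size (chebU k) <= k.+1)%N &
      (size (chebU k.+1) <= k.+1)%N].
Proof.
elim: k => [|k [sT sU sU1]].
  by rewrite chebUS /chebT /chebU /= mulr0 addr0 size_polyC oner_eq0 size_poly0.
have sX (p : {poly R}) : (size p <= k.+1)%N -> (size ('X * p)%R <= k.+2)%N.
  move=> sp; apply: leq_trans (size_polyMleq _ _) _; rewrite size_polyX.
  by rewrite add2n.
have sD (p p' : {poly R}) : (size p <= k.+2)%N -> (size p' <= k.+2)%N ->
    (size (p + p')%R <= k.+2)%N.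
  by move=> sp sp'; apply: leq_trans (size_polyD _ _) _; rewrite geq_max sp.
have sT1 : (size (chebT k.+1) <= k.+2)%N.
  have -> : chebT k.+1 = 'X * chebU k.+1 + - chebU k.
    by rewrite chebTS chebUS; ring.
  by apply: sD; rewrite ?sX // size_polyN (leq_trans sU).
by split=> //; [exact: leqW | rewrite chebUS sD // sX].
Qed.

(** The values at 2 are the coordinates of [(2 + sqrt 3)^k] in the basis
    [1, sqrt 3]. *)
Lemma cheb_at2 k : [/\ 0 <= (chebT k).[2], 0 <= (chebU k).[2] &
  (chebT k).[2] + Num.sqrt 3 * (chebU k).[2] = (2 + Num.sqrt 3) ^+ k].
Proof.
elim: k => [|k [T0 U0 E]].
  by rewrite /chebT /chebU /= !hornerE expr0 ler01.
have s3 : Num.sqrt (3 : R) ^+ 2 = 3 by rewrite sqr_sqrtr.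
have TE : (chebT k.+1).[2] = 2 * (chebT k).[2] + 3 * (chebU k).[2].
  by rewrite chebTS !hornerE; ring.
have UE : (chebU k.+1).[2] = (chebT k).[2] + 2 * (chebU k).[2].
  by rewrite chebUS !hornerE.
rewrite TE UE; split; [lra | lra |].
rewrite exprS -E; move: s3; set r := Num.sqrt 3 => s3.
by rewrite -s3; ring.
Qed.

(** By the Pell equation at 2, [3 U^2 = T^2 - 1], so [sqrt 3 U <= T]. *)
Lemma cheb_growth k : (2 + Num.sqrt 3) ^+ k <= 2 * (chebT k).[2].
Proof.
have [T0 U0 <-] := cheb_at2 k.
have /(congr1 (horner^~ 2)) := cheb_pell k.
rewrite !hornerE /= => pell.
have : Num.sqrt 3 * (chebU k).[2] <= (chebT k).[2].
  rewrite -(@ler_pXn2r _ 2) ?nnegrE ?mulr_ge0 ?sqrtr_ge0 //.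
  by rewrite exprMn sqr_sqrtr //; lra.
lra.
Qed.

(** [2 + sqrt 3 = (1 + u) / (1 - u)] with [u = 1 / sqrt 3]; the general
    inequality [exp(2 u) <= (1 + u) / (1 - u)] leaves enough room here for a
    numerical proof. *)
Lemma expR_le_base : expR (2 / Num.sqrt 3) <= 2 + Num.sqrt 3 :> R.
Proof.
set r := Num.sqrt (3 : R).
have r2 : r ^+ 2 = 3 by rewrite sqr_sqrtr.
have r0 : 0 <= r by exact: sqrtr_ge0.
have r_lb : 433 / 250 <= r.
  rewrite leNgt; apply/negP => h.
  by have := ltr_pM r0 r0 h h; rewrite -expr2 r2; lra.
have r_gt0 : 0 < r by lra.
have x_ub : 2 / r <= 1155 / 1000.
  by rewrite ler_pdivrMr //; lra.
set x := 2 / r in x_ub *.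
(* [exp(-x) >= (1 - x/8)^8], and [1 - x/8 >= 85/100] *)
have H : (85 / 100) ^+ 8 <= expR (- x).
  have -> : - x = (- x / 8) * 8%:R by field.
  rewrite expRM_natr lerXn2r ?nnegrE ?expR_ge0 //.
  by apply: le_trans (expR_ge1Dx _); lra.
have : expR x * expR (- x) = 1 by rewrite -expRD subrr expR0.
have := expR_gt0 x; move: H; set e := expR x; set f := expR (- x) => H e0 ef.
have := ler_wpM2l (ltW e0) H; rewrite ef; lra.
Qed.

Lemma pcg_steps_bound (eps : R) : 0 < eps ->
  2 / eps <= (2 + Num.sqrt 3) ^+ pcg_steps eps.
Proof.
move=> eps0; set k := pcg_steps eps.
have r_gt0 : 0 < Num.sqrt (3 : R) by rewrite sqrtr_gt0.
have kge : Num.sqrt 3 / 2 * ln (2 / eps) <= k%:R.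
  have : (Num.ceil (Num.sqrt 3 / 2 * ln (2 / eps)) <= k%:Z)%R.
    rewrite /k /pcg_steps gez0_abs ?le_max ?lexx ?orbT //.
  rewrite -(ler_int R); apply: le_trans; exact: Num.Theory.ceil_ge.
apply: (@le_trans _ _ (expR (2 / Num.sqrt 3) ^+ k)); last first.
  by rewrite lerXn2r ?nnegrE ?expR_ge0 ?addr_ge0 ?sqrtr_ge0 ?expR_le_base.
rewrite -expRM_natr -[leLHS]lnK ?posrE ?divr_gt0 // ler_expR.
rewrite mulrAC ler_pdivlMr // [leRHS]mulrC; move: kge.
by rewrite mulrAC ler_pdivrMr // [leLHS]mulrC.
Qed.

End Chebyshev.

(** * Convergence of preconditioned conjugate gradients *)

Section PCG.
Context {R : realType}.

Lemma mulmx_tr_eq0 m n (Y : 'M[R]_(m, n)) : Y^T *m Y = 0 -> Y = 0.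
Proof.
move=> YY; apply/matrixP => i j; rewrite [RHS]mxE.
have /dotc_eq0 /colP /(_ i) : dotc (col j Y) (col j Y) = 0.
  have -> : dotc (col j Y) (col j Y) = (Y^T *m Y) j j.
    by rewrite dotcE mxE; apply: eq_bigr => k _; rewrite !mxE.
  by rewrite YY mxE.
by rewrite !mxE.
Qed.

(** [Y^T Y] and [Y] have the same kernel; this makes the normal equations of a
    least squares problem solvable. *)
Lemma sub_gram m n (Y : 'M[R]_(m, n)) : (Y <= Y^T *m Y)%MS.
Proof.
rewrite submxE; apply/eqP/mulmx_tr_eq0.
by rewrite trmx_mul -mulmxA (mulmxA Y^T) mulmx_coker mulmx0.
Qed.

Lemma posdef_unit n (A : 'M[R]_n) : A^T = A ->
  (forall u : 'cV[R]_n, u != 0 -> 0 < dotc u (A *m u)) -> A \in unitmx.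
Proof.
move=> sA pA; have [L Lu ->] := posdef_factor sA pA.
by rewrite unitmx_mul unitmx_tr Lu.
Qed.

(** Existence of the minimizer, without which the iterate would be a default
    value. It is found by the normal equations, whose solution has a residual
    orthogonal to the Krylov space for the inner product of [A]. *)
Lemma krylov_minimizer n (A M : 'M[R]_n) (y c : 'cV[R]_n) t : A^T = A ->
  (forall u : 'cV[R]_n, u != 0 -> 0 < dotc u (A *m u)) ->
  exists x, krylov A M y t x /\
    forall z, krylov A M y t z -> normA A (x - c) <= normA A (z - c).
Proof.
move=> sA pA; have [L Lu AE] := posdef_factor sA pA.
pose b (j : 'I_t) := (invmx M *m A) ^+ j *m (invmx M *m y).
pose W : 'M[R]_(n, t) := \matrix_(i, j) b j i 0.
have WE (a : 'cV[R]_t) : W *m a = \sum_j a j 0 *: b j.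
  apply/colP => i; rewrite mxE summxE; apply: eq_bigr => j _.
  by rewrite !mxE mulrC.
have kryW z : krylov A M y t z -> exists a, z = W *m a.
  move=> [a ->]; exists (\col_j a j); rewrite WE.
  by apply: eq_bigr => j _; rewrite mxE.
have [Y YE] : exists Y, Y = L^T *m W by exists (L^T *m W).
have /submxP[a aE] : ((L^T *m c)^T *m Y <= Y^T *m Y)%MS.
  by apply: submx_trans (submxMl _ _) (sub_gram Y).
have orth z : dotc (W *m z) (A *m (W *m a^T - c)) = 0.
  rewrite AE -mulmxA dotc_mulmxl mulmxBr.
  have -> : dotc z (W^T *m (L *m (L^T *m (W *m a^T) - L^T *m c))) =
      dotc z (Y^T *m Y *m a^T - Y^T *m (L^T *m c)).
    by rewrite YE !mulmxBr trmx_mul trmxK !mulmxA.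
  have -> : Y^T *m Y *m a^T = Y^T *m (L^T *m c).
    have := congr1 trmx aE.
    by rewrite trmx_mul trmxK (trmx_mul a) (trmx_mul Y^T) trmxK => <-.
  by rewrite subrr dotc0r.
exists (W *m a^T); split.
  by exists (fun j => a^T j 0); rewrite WE.
move=> _ /kryW[z ->]; rewrite !normAE ler_sqrt; last first.
  by rewrite AE dotc_gram dotc_ge0.
set x := W *m a^T; set e := x - c.
have -> : W *m z - c = W *m (z - a^T) + e by rewrite mulmxBr addrA subrK.
set f := W *m _.
have fe : dotc f (A *m e) = 0 by exact: orth.
have ef : dotc e (A *m f) = 0 by rewrite dotcC dotc_mulmxl sA.
clearbody e f.
rewrite mulmxDr !(dotcDl, dotcDr) fe ef addr0 add0r lerDr.
by rewrite AE dotc_gram dotc_ge0.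
Qed.

Section Bound.
Variables (n : nat) (A M : 'M[R]_n.+1).
Hypotheses (sA : A^T = A) (sM : M^T = M).
Hypothesis pA : forall u : 'cV[R]_n.+1, u != 0 -> 0 < dotc u (A *m u).
Hypothesis pM : forall u : 'cV[R]_n.+1, u != 0 -> 0 < dotc u (M *m u).
Hypothesis AM : forall u : 'cV[R]_n.+1, dotc u (A *m u) <= 3 / 2 * dotc u (M *m u).
Hypothesis MA : forall u : 'cV[R]_n.+1, dotc u (M *m u) <= 2 * dotc u (A *m u).

Let B := invmx M *m A.

Lemma posdef_ge0 (C : 'M[R]_n.+1) :
  (forall u : 'cV[R]_n.+1, u != 0 -> 0 < dotc u (C *m u)) ->
  forall u : 'cV[R]_n.+1, 0 <= dotc u (C *m u).
Proof.
by move=> pC u; have [->|/pC/ltW//] := eqVneq u 0; rewrite mulmx0 dotc0r.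
Qed.

(** With [v = B u] one has [M v = A u]; the two bounds come from expanding
    [0 <= |u - 2/3 v|_A^2] and [0 <= |v - 1/2 u|_M^2]. *)
Lemma precond_spectrum (u : 'cV[R]_n.+1) :
  dotc u (A *m u) <= 2 * dotc u (A *m (B *m u)) <= 3 * dotc u (A *m u).
Proof.
set v := B *m u.
have Mv : M *m v = A *m u by rewrite /v /B !mulmxA mulmxV ?mul1mx // posdef_unit.
have uAv : dotc u (A *m v) = dotc v (M *m v) by rewrite Mv dotcC dotc_mulmxl sA.
have vAu : dotc v (A *m u) = dotc v (M *m v) by rewrite Mv.
have uMv : dotc u (M *m v) = dotc u (A *m u) by rewrite Mv.
have vMu : dotc v (M *m u) = dotc u (A *m u) by rewrite -uMv dotcC dotc_mulmxl sM.
have H1 := posdef_ge0 pA (u - (2 / 3) *: v).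
have H2 := posdef_ge0 pM (v - (1 / 2) *: u).
have H3 := AM v; have H4 := MA u.
move: H1 H2; rewrite uAv !mulmxBr -!scalemxAr.
rewrite !(dotcDl, dotcDr, dotcNl, dotcNr, dotcZl, dotcZr) uAv vAu uMv vMu.
by move=> H1 H2; apply/andP; split; lra.
Qed.

Local Notation ev := (horner_mx B).

(** [A B = A M^-1 A] is symmetric. *)
Lemma ev_selfadjoint p : A *m ev p = (ev p)^T *m A.
Proof.
elim/poly_ind: p => [|p a IHp]; first by rewrite rmorph0 trmx0 mulmx0 mul0mx.
have AB : A *m B = B^T *m A.
  by rewrite /B trmx_mul trmx_inv sA sM !mulmxA.
rewrite rmorphD rmorphM /= horner_mx_X horner_mx_C mulmxDr [X in X *m A]linearD /= mulmxDl.
rewrite tr_scalar_mx scalar_mxC; congr (_ + _).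
have comm : ev p * B = B * ev p.
  have evM r r' : ev (r * r') = ev r * ev r' by exact: rmorphM.
  by rewrite -[X in _ * X = _](horner_mx_X B) -evM mulrC evM horner_mx_X.
by rewrite {1}comm -!mulmxE mulmxA AB -(mulmxA B^T) IHp (trmx_mul (ev p) B) mulmxA.
Qed.

Lemma ev_sq_norm p (u : 'cV[R]_n.+1) :
  dotc u (A *m (ev (p ^+ 2) *m u)) = dotc (ev p *m u) (A *m (ev p *m u)).
Proof.
have -> : ev (p ^+ 2) = ev p *m ev p by rewrite expr2 rmorphM.
by rewrite -(mulmxA (ev p)) (mulmxA A) ev_selfadjoint -(mulmxA _ A) -dotc_mulmxl.
Qed.

(** [1 - X^2 = ((1 - X) (1 + X) (1 - X) + (1 + X) (1 - X) (1 + X)) / 2]: since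
    [1 - X = 2 B - 1] and [1 + X = 3 - 2 B] are positive, each summand is a
    positive operator between two copies of a self-adjoint one. *)
Lemma ev_pell_ge0 (w : 'cV[R]_n.+1) (X := 2%:P - 2%:P * 'X) :
  0 <= dotc w (A *m (ev (1 - X ^+ 2) *m w)).
Proof.
have posE (r : {poly R}) : r = 1 - X \/ r = 1 + X ->
    forall u : 'cV[R]_n.+1, 0 <= dotc u (A *m (ev r *m u)).
  move=> rE u; have /andP[lo hi] := precond_spectrum u.
  have evu a b : ev (a%:P + b%:P * 'X) *m u = a *: u + b *: (B *m u).
    rewrite rmorphD rmorphM /= !horner_mx_C horner_mx_X mulmxDl.
    by rewrite mul_scalar_mx -mulmxE -mulmxA mul_scalar_mx.
  have [->|->] : r = (-1)%:P + 2%:P * 'X \/ r = 3%:P + (- 2)%:P * 'X.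
    by case: rE => ->; [left | right]; rewrite /X !polyCN -?polyC1; ring.
  - by rewrite evu mulmxDr -!scalemxAr dotcDr !dotcZr; lra.
  - by rewrite evu mulmxDr -!scalemxAr dotcDr !dotcZr; lra.
have sandwich (r r' : {poly R}) :
    (forall u : 'cV[R]_n.+1, 0 <= dotc u (A *m (ev r *m u))) ->
    0 <= dotc w (A *m (ev (r' * r * r') *m w)).
  move=> Hr; have -> : ev (r' * r * r') = ev r' *m ev r *m ev r' by rewrite !rmorphM.
  rewrite -(mulmxA (ev r' *m ev r)) -(mulmxA (ev r')) (mulmxA A) ev_selfadjoint.
  by rewrite -(mulmxA _ A) -dotc_mulmxl.
pose E := 1 - X; pose F := 1 + X.
have -> : 1 - X ^+ 2 = (1 / 2)%:P * (E * F * E + F * E * F).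
  have -> : E * F * E + F * E * F = 2%:P * (1 - X ^+ 2).
    by rewrite /E /F (_ : 2%:P = 2) //; ring.
  by rewrite mulrA -polyCM (_ : 1 / 2 * 2 = 1) ?mul1r //; field.
have -> : ev ((1 / 2)%:P * (E * F * E + F * E * F)) =
    (1 / 2) *: (ev (E * F * E) + ev (F * E * F)).
  by rewrite rmorphM rmorphD /= horner_mx_C -mulmxE mul_scalar_mx.
rewrite -scalemxAl -scalemxAr dotcZr mulmxDl mulmxDr dotcDr.
by rewrite mulr_ge0 ?divr_ge0 // addr_ge0 // sandwich //; apply: posE; auto.
Qed.

(** The Pell equation gives [|u|^2 = |T(X) u|^2 + <U(X) u, (1 - X^2) U(X) u>],
    in the inner product of [A]. *)
Lemma cheb_contract k (X := 2%:P - 2%:P * 'X : {poly R}) (u : 'cV[R]_n.+1) :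
  normA A (ev (chebT k \Po X) *m u) <= normA A u.
Proof.
rewrite !normAE ler_sqrt ?posdef_ge0 //.
have pell : (chebT k \Po X) ^+ 2 +
    (chebU k \Po X) * (1 - X ^+ 2) * (chebU k \Po X) = 1.
  have := congr1 (comp_poly X) (cheb_pell k).
  rewrite !expr2 !(comp_polyB, comp_polyD, comp_polyM, comp_polyX).
  by rewrite -polyC1 comp_polyC polyC1 => H; rewrite -[RHS]H; ring.
have evE : ev ((chebT k \Po X) ^+ 2) *m u +
   ev (chebU k \Po X) *m (ev (1 - X ^+ 2) *m (ev (chebU k \Po X) *m u)) = u.
  have := congr1 (fun r => ev r *m u) pell.
  rewrite /= rmorph1 mul1mx rmorphD /= mulmxDl => E1; rewrite -[RHS]E1; congr (_ + _).
  have evM r r' : ev (r * r') = ev r *m ev r' by exact: rmorphM.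
  by rewrite !evM !mulmxA.
rewrite -[X in _ <= dotc _ (A *m X)]evE mulmxDr dotcDr ev_sq_norm lerDl.
by rewrite (mulmxA A) ev_selfadjoint -(mulmxA _ A) -dotc_mulmxl ev_pell_ge0.
Qed.

(** [p(B) c - p(0) c] is a combination of [B^(j+1) c] for [j < t], and
    [B c = M^-1 y] starts the Krylov sequence. *)
Lemma krylov_poly t (p : {poly R}) (y c : 'cV[R]_n.+1) : A *m c = y ->
  (size p <= t.+1)%N -> p.[0] != 0 ->
  krylov A M y t (c - p.[0]^-1 *: (ev p *m c)).
Proof.
move=> Ac sp p0; have By : B *m c = invmx M *m y by rewrite /B -mulmxA Ac.
exists (fun j => - p.[0]^-1 * p`_j.+1).
have pE : p = p.[0]%:P + (\sum_(j < t) p`_j.+1 *: 'X^j) * 'X.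
  rewrite horner_coef0; apply/polyP => i; rewrite coefD coefC coefMX.
  case: i => [|i] /=; first by rewrite addr0.
  rewrite add0r; have [it|ti] := ltnP i t.
    rewrite coef_sum (bigD1 (Ordinal it)) //= coefZ coefXn eqxx mulr1.
    rewrite big1 ?addr0 // => j ji; rewrite coefZ coefXn.
    rewrite (_ : i == j = false) ?mulr0 //. 
    by apply: contraNF ji => /eqP ij; apply/eqP/val_inj; rewrite /= ij.
  rewrite nth_default ?(leq_trans sp) // coef_sum big1 // => j _.
  rewrite coefZ coefXn gtn_eqF ?mulr0 //; exact: leq_trans (ltn_ord j) ti.
have evp : ev p *m c = p.[0] *: c + \sum_(j < t) p`_j.+1 *: (B ^+ j *m (invmx M *m y)).
  rewrite {1}pE rmorphD rmorphM /= horner_mx_C horner_mx_X mulmxDl mul_scalar_mx.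
  congr (_ + _); rewrite -mulmxE -mulmxA By raddf_sum mulmx_suml.
  apply: eq_bigr => j _; rewrite /= -mul_polyC rmorphM rmorphXn /= horner_mx_C horner_mx_X.
  by rewrite -mulmxE mul_scalar_mx -scalemxAl.
rewrite evp scalerDr scalerA mulVf // scale1r opprD addrA subrr add0r.
rewrite scaler_sumr -sumrN; apply: eq_bigr => j _.
by rewrite scalerA -scaleNr mulNr.
Qed.

(** Compare the minimizer with the element of the Krylov space given by
    [p = T_t(2 - 2 z)], normalized by [p(0) = T_t(2)]. *)
Lemma pcg_bound (y c : 'cV[R]_n.+1) eps : 0 < eps -> A *m c = y ->
  normA A (pcg_iterate A M y (pcg_steps eps) - c) <= eps * normA A c.
Proof.
move=> eps0 Ac; set t := pcg_steps eps.
have cE : invmx A *m y = c by rewrite -Ac mulmxA mulVmx ?mul1mx // posdef_unit.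
rewrite /pcg_iterate cE.
have [_ xmin] := xgetPex 0 (krylov_minimizer M y c t sA pA).
set X := 2%:P - 2%:P * 'X : {poly R}.
pose p := chebT t \Po X.
have X0 : X.[0] = 2 by rewrite /X !hornerE /= ?mulr0 ?subr0.
have p0E : p.[0] = (chebT t).[2] by rewrite horner_comp X0.
have growth := le_trans (pcg_steps_bound eps0) (cheb_growth t).
have p0_lb : eps^-1 <= p.[0].
  by rewrite p0E; move: growth; rewrite -/t ler_pM2l.
have p0_gt0 : 0 < p.[0] by apply: lt_le_trans p0_lb; rewrite invr_gt0.
have sX : (size X <= 2)%N.
  rewrite /X (leq_trans (size_polyD _ _)) // geq_max size_polyN mul_polyC.
  by rewrite (leq_trans (size_polyC_leq1 _)) // (leq_trans (size_scale_leq _ _)) // size_polyX.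
have sp : (size p <= t.+1)%N.
  have [sT _ _] := size_cheb (R := R) t.
  apply: leq_trans (size_comp_poly_leq _ _) _; rewrite ltnS.
  apply: (@leq_trans (t * 1)); last by rewrite muln1.
  by apply: leq_mul; [case: (size _) sT | case: (size _) sX].
apply: le_trans (xmin _ (krylov_poly Ac sp (lt0r_neq0 p0_gt0))) _.
rewrite addrC addKr.
have normAZ a u : normA A (a *: u) = `|a| * normA A u.
  rewrite !normAE -scalemxAr dotcZl dotcZr mulrA -expr2 sqrtrM ?sqr_ge0 //.
  by rewrite sqrtr_sqr.
rewrite -scaleNr normAZ normrN ger0_norm ?invr_ge0 ?(ltW p0_gt0) //.
apply: ler_pM; rewrite ?invr_ge0 ?sqrtr_ge0 ?(ltW p0_gt0) //.
  by rewrite invf_ple ?posrE.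
exact: cheb_contract.
Qed.

End Bound.
End PCG.

(** * Sums over four multi-indices *)

Section FfunCons.
Variables (X : finType) (q : nat) (k : 'I_q.+1).

Definition fcons (x : X) (f : {ffun 'I_q -> X}) : {ffun 'I_q.+1 -> X} :=
  [ffun i => if unlift k i is Some j then f j else x].

Lemma fcons_head x f : fcons x f k = x.
Proof. by rewrite ffunE unlift_none. Qed.

Lemma fcons_tail x f j : fcons x f (lift k j) = f j.
Proof. by rewrite ffunE liftK. Qed.

Lemma sum_fcons (V : nmodType) (F : {ffun 'I_q.+1 -> X} -> V) :
  \sum_f F f = \sum_x \sum_f F (fcons x f).
Proof.
rewrite pair_bigA /=.
rewrite (reindex (fun p : X * {ffun 'I_q -> X} => fcons p.1 p.2)) //=.
exists (fun f => (f k, [ffun j => f (lift k j)])) => [[x f] _|f _] /=.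
  by rewrite fcons_head; congr (_, _); apply/ffunP => j; rewrite ffunE fcons_tail.
apply/ffunP => i; rewrite ffunE; case: unliftP => [j ->|->] //.
by rewrite ffunE.
Qed.

End FfunCons.

Section FourPoint.
Context {R : realType}.

Definition l2norm (T : finType) (w : T -> R) := Num.sqrt (\sum_i w i ^+ 2).

Lemma l2norm_ge0 (T : finType) (w : T -> R) : 0 <= l2norm w.
Proof. exact: sqrtr_ge0. Qed.

Lemma l2norm_sqr (T : finType) (w : T -> R) : l2norm w ^+ 2 = \sum_i w i ^+ 2.
Proof. by rewrite sqr_sqrtr // sumr_ge0 // => i _; exact: sqr_ge0. Qed.

Lemma l2norm_CauchySchwarz (T : finType) (w x : T -> R) :
  \sum_i w i * x i <= l2norm w * l2norm x.
Proof.
apply: le_trans (ler_norm _) _.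
rewrite -(@ler_pXn2r _ 2) ?nnegrE ?mulr_ge0 ?l2norm_ge0 //.
rewrite real_normK ?num_real // exprMn !l2norm_sqr.
have := CauchySchwarz_dotc (\col_(i < #|T|) w (enum_val i))
                           (\col_(i < #|T|) x (enum_val i)).
have E (u v : T -> R) : dotc (\col_(i < #|T|) u (enum_val i))
    (\col_(i < #|T|) v (enum_val i)) = \sum_i u i * v i.
  by rewrite dotcE [RHS]big_enum_val; apply: eq_bigr => i _; rewrite !mxE.
have E2 (u : T -> R) : \sum_i u i * u i = \sum_i u i ^+ 2 by apply: eq_bigr.
by rewrite !E !E2.
Qed.

(** Three matchings of four entries. The sum dominates the indicator of the
    event that the four entries match in pairs, and unlike that indicator it
    factors in sums over the entries. *)
Definition pairings (T : eqType) (a b c d : T) : R :=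
  (a == b)%:R * (c == d)%:R + (a == c)%:R * (b == d)%:R +
  (a == d)%:R * (b == c)%:R.

Lemma pairings_ge0 (T : eqType) (a b c d : T) : 0 <= pairings a b c d.
Proof. by rewrite /pairings !addr_ge0 // mulr_ge0. Qed.

Lemma sum_delta (T : finType) (a : T) (F : T -> R) :
  \sum_b (a == b)%:R * F b = F a.
Proof.
rewrite (bigD1 a) //= eqxx mul1r big1 ?addr0 // => b ba.
by rewrite eq_sym (negPf ba) mul0r.
Qed.

(** Each matching gives a product of two inner products. *)
Lemma four_point_base (T : finType) (w x y z : T -> R) :
  (forall i, 0 <= w i) -> (forall i, 0 <= x i) ->
  (forall i, 0 <= y i) -> (forall i, 0 <= z i) ->
  \sum_a \sum_b \sum_c \sum_d pairings a b c d * (w a * x b * y c * z d) <=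
  3 * (l2norm w * l2norm x * l2norm y * l2norm z).
Proof.
move=> w0 x0 y0 z0.
have -> : \sum_a \sum_b \sum_c \sum_d pairings a b c d * (w a * x b * y c * z d) =
   (\sum_a w a * x a) * (\sum_a y a * z a) + (\sum_a w a * y a) * (\sum_a x a * z a)
   + (\sum_a w a * z a) * (\sum_a x a * y a).
  rewrite !big_distrlr -!big_split; apply: eq_bigr => a _ /=.
  transitivity (\sum_b ((a == b)%:R * (\sum_c (\sum_d (c == d)%:R * (w a * x b * y c * z d)))
     + \sum_c (a == c)%:R * (\sum_d (b == d)%:R * (w a * x b * y c * z d))
     + \sum_d (a == d)%:R * (\sum_c (b == c)%:R * (w a * x b * y c * z d)))).
    apply: eq_bigr => b _; rewrite mulr_sumr -big_split /=.
    rewrite [X in _ = _ + X](_ : _ = \sum_c \sum_d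
        (a == d)%:R * ((b == c)%:R * (w a * x b * y c * z d))); last first.
      by rewrite exchange_big /=; apply: eq_bigr => d _; rewrite mulr_sumr.
    rewrite -big_split /=; apply: eq_bigr => c _.
    rewrite !mulr_sumr -!big_split /=; apply: eq_bigr => d _.
    rewrite /pairings; ring.
  rewrite !big_split /=; congr (_ + _ + _).
  - rewrite sum_delta; apply: eq_bigr => c _; rewrite sum_delta; ring.
  - apply: eq_bigr => b _; rewrite sum_delta sum_delta; ring.
  - apply: eq_bigr => b _; rewrite sum_delta sum_delta; ring.
have CS (u v u' v' : T -> R) : (forall i, 0 <= u i) -> (forall i, 0 <= v i) ->
    (forall i, 0 <= u' i) -> (forall i, 0 <= v' i) ->
    (\sum_a u a * v a) * (\sum_a u' a * v' a) <=
    l2norm u * l2norm v * (l2norm u' * l2norm v').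
  by move=> *; apply: ler_pM; rewrite ?l2norm_CauchySchwarz ?sumr_ge0 // => i _;
    exact: mulr_ge0.
have := CS w x y z w0 x0 y0 z0.
have := CS w y x z w0 y0 x0 z0.
have := CS w z x y w0 z0 x0 y0.
lra.
Qed.

(** The norm of a tensor is the norm of the vector of norms of its slices. *)
Lemma l2norm_fcons (D : finType) q (w : {ffun 'I_q.+1 -> D} -> R) :
  l2norm (fun a => l2norm (fun I => w (fcons ord0 a I))) = l2norm w.
Proof.
congr Num.sqrt; rewrite (sum_fcons ord0); apply: eq_bigr => a _.
by rewrite l2norm_sqr.
Qed.

(** Induction on the order of the tensors: for fixed first coordinates the
    induction hypothesis bounds the sum by norms of slices, to which the case of
    vectors applies. A direct use of the Cauchy-Schwarz inequality on whole
    multi-indices fails, since the matching may differ from one coordinate to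
    another. *)
Lemma four_point (D : finType) q (w x y z : {ffun 'I_q -> D} -> R) :
  (forall i, 0 <= w i) -> (forall i, 0 <= x i) ->
  (forall i, 0 <= y i) -> (forall i, 0 <= z i) ->
  \sum_(I : {ffun 'I_q -> D}) \sum_(J : {ffun 'I_q -> D})
  \sum_(K : {ffun 'I_q -> D}) \sum_(L : {ffun 'I_q -> D})
     (\prod_(k < q) pairings (I k) (J k) (K k) (L k)) *
     (w I * x J * y K * z L) <=
  3 ^+ q * (l2norm w * l2norm x * l2norm y * l2norm z).
Proof.
elim: q w x y z => [|q IHq] w x y z w0 x0 y0 z0.
  pose e : {ffun 'I_0 -> D} :=
    [ffun i : 'I_0 => let: Ordinal m lt := i in False_rect D (notF lt)].
  have eE f : f = e by apply/ffunP => [[]].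
  have sum1 (F : {ffun 'I_0 -> D} -> R) : \sum_f F f = F e.
    by rewrite (bigD1 e) //= big1 ?addr0 // => f /eqP []; exact: eE.
  rewrite !sum1 big_ord0 expr0 !mul1r.
  by rewrite /l2norm !sum1 !sqrtr_sqr !ger0_norm.
have IH a b c d := IHq (fun I => w (fcons ord0 a I)) (fun I => x (fcons ord0 b I))
  (fun I => y (fcons ord0 c I)) (fun I => z (fcons ord0 d I))
  (fun _ => w0 _) (fun _ => x0 _) (fun _ => y0 _) (fun _ => z0 _).
have := @four_point_base D (fun a => l2norm (fun I => w (fcons ord0 a I)))
  (fun a => l2norm (fun I => x (fcons ord0 a I)))
  (fun a => l2norm (fun I => y (fcons ord0 a I)))
  (fun a => l2norm (fun I => z (fcons ord0 a I)))
  (fun _ => l2norm_ge0 _) (fun _ => l2norm_ge0 _) (fun _ => l2norm_ge0 _)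
  (fun _ => l2norm_ge0 _).
rewrite !l2norm_fcons => base.
rewrite exprSr -mulrA; apply: le_trans (ler_wpM2l _ base); last exact: exprn_ge0.
(* The first coordinate of each multi-index is moved outwards in turn. *)
rewrite (sum_fcons ord0) mulr_sumr; apply: ler_sum => a _.
rewrite mulr_sumr; under eq_bigr do rewrite (sum_fcons ord0).
rewrite exchange_big; apply: ler_sum => b _.
rewrite mulr_sumr; under eq_bigr do under eq_bigr do rewrite (sum_fcons ord0).
under eq_bigr do rewrite exchange_big.
rewrite exchange_big; apply: ler_sum => c _.
rewrite mulr_sumr; under eq_bigr do under eq_bigr do under eq_bigr do
  rewrite (sum_fcons ord0).
under eq_bigr do under eq_bigr do rewrite exchange_big.
under eq_bigr do rewrite exchange_big.
rewrite exchange_big; apply: ler_sum => d _.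
rewrite mulrCA; apply: le_trans (ler_wpM2l (pairings_ge0 a b c d) (IH a b c d)).
rewrite mulr_sumr; apply: ler_sum => I _.
rewrite mulr_sumr; apply: ler_sum => J _.
rewrite mulr_sumr; apply: ler_sum => K _.
rewrite mulr_sumr; apply: ler_sum => L _.
rewrite big_ord_recl !fcons_head.
under eq_bigr => k _ do rewrite !fcons_tail.
by rewrite !mulrA lexx.
Qed.

End FourPoint.

(** * Weights with limited independence *)

Section Weights.
Context {R : realType}.

(** [p] is the probability mass function of a random function with uniform
    marginals on at most [k] points. *)
Definition kwise_weights (k : nat) (A B : finType) (p : {ffun A -> B} -> R) :=
  (forall f, 0 <= p f) /\
  forall (S : {set A}) (v : A -> B), (#|S| <= k)%N ->
    \sum_(f : {ffun A -> B} | [forall a in S, f a == v a]) p f =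
    #|B|%:R ^- #|S|.

Lemma kwise_weights_total k (A B : finType) (p : {ffun A -> B} -> R) (b : B) :
  kwise_weights k p -> \sum_f p f = 1.
Proof.
move=> [_ /(_ finset.set0 (fun=> b))]; rewrite cards0 expr0 invr1 => /(_ isT) <-.
by apply: eq_bigl => f; apply/esym/forall_inP => a; rewrite inE.
Qed.

Section Signs.
Variables (D : finType) (p : {ffun D -> bool} -> R).
Hypothesis p4 : kwise_weights 4 p.
Variables a b c d : D.

Let sgn (f : {ffun D -> bool}) : R :=
  (-1) ^+ f a * (-1) ^+ f b * (-1) ^+ f c * (-1) ^+ f d.

Let S : {set D} := [set a; b; c; d]%SET.
Let restr (f : {ffun D -> bool}) : {ffun D -> bool} := [ffun x => (x \in S) && f x].
Let flip (e : D) (f : {ffun D -> bool}) : {ffun D -> bool} :=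
  [ffun x => f x (+) (x == e)].

(** The product of signs depends only on the restriction to the four points,
    represented by its extension by [false]; these restrictions are uniform. *)
Lemma sign_marginal :
  \sum_f p f * sgn f = 2 ^- #|S| * \sum_(v | restr v == v) sgn v.
Proof.
have cS : (#|S| <= 4)%N.
  do 2![apply: leq_trans (leq_card_setU _ _) _; rewrite cards1 addn1 ltnS].
  by rewrite cards2 ltnS leq_b1.
have sgn_restr f : sgn (restr f) = sgn f.
  by rewrite /sgn /restr !ffunE !inE !eqxx ?orbT.
have restrK f : restr (restr f) = restr f.
  by apply/ffunP => x; rewrite !ffunE andbA andbb.
rewrite (partition_big restr (fun v => restr v == v)) /=; last first.
  by move=> f _; rewrite restrK.
rewrite mulr_sumr; apply: eq_bigr => v /eqP rv.
rewrite (eq_bigr (fun f => p f * sgn v)); last first.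
  by move=> f /eqP <-; rewrite sgn_restr.
rewrite -mulr_suml; congr (_ * _).
have := p4.2 S v cS; rewrite card_bool => <-.
apply: eq_bigl => f; apply/eqP/forall_inP => [<- x xS|H].
  by rewrite ffunE xS.
apply/ffunP => x; rewrite -rv !ffunE.
by case xS : (x \in S) => //=; have /eqP := H x xS.
Qed.

(** Flipping the sign at a point of odd multiplicity preserves the uniform
    distribution and changes the sign of the product. *)
Lemma sign_odd e : (a == e) (+) (b == e) (+) (c == e) (+) (d == e) ->
  \sum_f p f * sgn f = 0.
Proof.
move=> odd_e; rewrite sign_marginal.
suff -> : \sum_(v | restr v == v) sgn v = 0 by rewrite mulr0.
have eS : e \in S.
  by rewrite !inE; move: odd_e; rewrite !(eq_sym e); do 4!case: (_ == e).
have flipK : involutive (flip e).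
  by move=> f; apply/ffunP => x; rewrite !ffunE addbK.
have restr_flip f : (restr (flip e f) == flip e f) = (restr f == f).
  have comm : restr (flip e f) = flip e (restr f).
    apply/ffunP => x; rewrite !ffunE.
    by case: (eqVneq x e) => [->|_]; rewrite ?eS ?addbF.
  by rewrite comm (inj_eq (inv_inj flipK)).
have sgn_flip f : sgn (flip e f) = - sgn f.
  rewrite /sgn !ffunE !signr_addb.
  transitivity ((-1) ^+ ((a == e) (+) (b == e) (+) (c == e) (+) (d == e)) * sgn f).
    by rewrite !signr_addb /sgn; ring.
  by rewrite odd_e mulN1r.
set s := \sum_(v | _) _.
have : s = - s.
  rewrite {1}/s (reindex_inj (inv_inj flipK)) /= -sumrN.
  by apply: eq_big => f; rewrite ?restr_flip.
lra.
Qed.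

Lemma sign_four_point : `|\sum_f p f * sgn f| <= pairings a b c d.
Proof.
have [paired|] := boolP [|| (a == b) && (c == d), (a == c) && (b == d) |
                           (a == d) && (b == c)].
  apply: (@le_trans _ _ 1).
    apply: le_trans (ler_norm_sum _ _ _) _.
    rewrite -(kwise_weights_total true p4); apply: ler_sum => f _.
    by rewrite !normrM !normrX !normrN1 !expr1n !mulr1 ger0_norm // p4.1.
  rewrite /pairings -!natrM -!natrD !mulnb ler1n.
  by move: paired; do 3!case: (_ && _).
move=> unpaired.
suff [e /sign_odd ->] : exists e,
    (a == e) (+) (b == e) (+) (c == e) (+) (d == e).
  by rewrite normr0 pairings_ge0.
have [ab|ab] := eqVneq a b.
  rewrite -ab eqxx /= in unpaired *; exists c.
  by move: unpaired; rewrite addbb eqxx (eq_sym d); case: (c == d).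
have [ac|ac] := eqVneq a c; have [ad|ad] := eqVneq a d.
- by exists a; rewrite -ac -ad eqxx (eq_sym b) (negPf ab).
- exists b; move: unpaired; rewrite -ac eqxx (negPf ab) (negPf ad) (eq_sym b d) eqxx.
  by rewrite /= orbF => /negPf ->.
- exists b; move: unpaired; rewrite -ad eqxx (negPf ab) (negPf ac) (eq_sym b c) eqxx.
  by rewrite /= => /negPf ->.
- by exists a; rewrite eqxx (eq_sym b) (negPf ab) (eq_sym c) (negPf ac) (eq_sym d) (negPf ad).
Qed.

End Signs.

Section Hashes.
Variables (D : finType) (s : nat) (p : {ffun D -> 'I_s.+1} -> R).
Hypothesis p2 : kwise_weights 2 p.

(** Once the value at [j] is fixed, a single value at [i] produces a collision,
    and the two values are jointly uniform. *)
Lemma hash_collision (i j : D) (c c' : nat) : i != j ->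
  \sum_t p t * ((t i + c) %% s.+1 == (t j + c') %% s.+1)%N%:R <= s.+1%:R^-1.
Proof.
move=> ij.
(* the value at [i] that collides with the value [b] at [j] *)
pose g (b : 'I_s.+1) : 'I_s.+1 := inZp (b + c' + (s.+1 - c %% s.+1))%N.
pose S := [set i; j]%SET.
have cS : #|S| = 2 by rewrite cards2 ij.
pose v b x := if x == i then g b else b.
apply: (@le_trans _ _ (\sum_b
    \sum_(t : {ffun D -> 'I_s.+1} | [forall a in S, t a == v b a]) p t)).
  under [leRHS]eq_bigr do rewrite big_mkcond.
  rewrite exchange_big; apply: ler_sum => t _ /=.
  case: eqP => [coll|_]; last first.
    rewrite mulr0; apply: sumr_ge0 => b _; case: ifP => _ //; exact: p2.1.
  rewrite mulr1 (bigD1 (t j)) //= ifT ?lerDl.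
    by apply: sumr_ge0 => b _; case: ifP => _ //; exact: p2.1.
  apply/forall_inP => x; rewrite !inE => /orP[]/eqP ->; rewrite /v; last first.
    by rewrite (eq_sym j) (negPf ij).
  rewrite eqxx; apply/eqP/val_inj => /=.
  rewrite -modnDml -coll modnDml -addnA -(modnDmr (t i)) -(modnDml c).
  have cs : (c %% s.+1 <= s.+1)%N by rewrite ltnW // ltn_pmod.
  by rewrite subnKC // modnn addn0 modn_small.
under eq_bigr do rewrite p2.2 ?cS //.
rewrite sumr_const !card_ord -[leLHS]mulr_natl exprS invfM mulrA mulfV ?pnatr_eq0 //.
by rewrite mul1r expr1.
Qed.
End Hashes.

Lemma kwise_weightsW k k' (A B : finType) (p : {ffun A -> B} -> R) :
  (k <= k')%N -> kwise_weights k' p -> kwise_weights k p.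
Proof. by move=> kk' [p0 H]; split=> // S v Sk; apply: H; apply: leq_trans kk'. Qed.

Section Product.
Variables (X : finType) (q : nat) (p : 'I_q -> X -> R).

Definition prod_weights (f : {ffun 'I_q -> X}) : R := \prod_k p k (f k).

Lemma sum_prod_weights (F : 'I_q -> X -> R) :
  \sum_f prod_weights f * \prod_k F k (f k) = \prod_k \sum_x p k x * F k x.
Proof.
rewrite bigA_distr_bigA; apply: eq_bigr => f _.
by rewrite /prod_weights -big_split.
Qed.

Lemma sum_prod_weights1 : (forall k, \sum_x p k x = 1) ->
  \sum_f prod_weights f = 1.
Proof.
move=> p1; rewrite /prod_weights -(bigA_distr_bigA p) big1 // => k _; exact: p1.
Qed.

Lemma prod_weights_ge0 : (forall k x, 0 <= p k x) -> forall f, 0 <= prod_weights f.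
Proof. by move=> p0 f; apply: prodr_ge0. Qed.

End Product.

(** Fix all hash functions but that of a coordinate in which [I] and [J]
    differ. *)
Lemma tensor_collision (D : finType) q s
    (p : 'I_q -> {ffun D -> 'I_s.+1} -> R) (I J : {ffun 'I_q -> D}) :
  (forall k, kwise_weights 2 (p k)) -> I != J ->
  \sum_h prod_weights p h *
     ((\sum_(k < q) h k (I k)) %% s.+1 == (\sum_(k < q) h k (J k)) %% s.+1)%N%:R
  <= s.+1%:R^-1.
Proof.
move=> p2 IJ.
have [k Ik] : exists k, I k != J k.
  by apply/existsP; apply: contraNT IJ => /existsPn H; apply/eqP/ffunP => k;
    apply/eqP; have := H k; rewrite negbK.
case: q p I J p2 IJ k Ik => [|q] p I J p2 IJ k Ik; first by case: k {Ik}.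
rewrite (sum_fcons k) exchange_big /=.
pose p' j := p (lift k j).
apply: (@le_trans _ _ (\sum_h prod_weights p' h * s.+1%:R^-1)); last first.
  rewrite -mulr_suml sum_prod_weights1 ?mul1r // => j.
  exact: kwise_weights_total ord0 (p2 _).
apply: ler_sum => h _.
have p'0 : 0 <= prod_weights p' h by apply: prod_weights_ge0 => j f; exact: (p2 _).1.
apply: le_trans (ler_wpM2l p'0 (hash_collision (p2 k)
  (\sum_(j < q) h j (I (lift k j))) (\sum_(j < q) h j (J (lift k j))) Ik)).
rewrite mulr_sumr; apply: ler_sum => t _.
have sumE (I' : {ffun 'I_q.+1 -> D}) : (\sum_(l < q.+1) (fcons k t h) l (I' l) =
    t (I' k) + \sum_(j < q) h j (I' (lift k j)))%N.
  rewrite (bigD1_ord k) //= fcons_head; congr (_ + _)%N.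
  by apply: eq_bigr => j _; rewrite fcons_tail.
rewrite !sumE /prod_weights (bigD1_ord k) //= fcons_head.
rewrite mulrA [p k t * _]mulrC.
by under eq_bigr do rewrite fcons_tail.
Qed.

End Weights.

(** * Second moment of the sketching error *)

Section Moment.
Context {R : realType}.

(** Expanding the square separates the two independent sources of randomness. *)
Lemma sum_sqr_exchange (X Y Z : finType) (P : X -> R) (Q : Y -> R)
    (c : X -> Z -> R) (t : Y -> Z -> R) (w : Z -> R) :
  \sum_h \sum_g P h * Q g * (\sum_x c h x * t g x * w x) ^+ 2 =
  \sum_x \sum_y (w x * w y) * (\sum_h P h * (c h x * c h y)) *
    (\sum_g Q g * (t g x * t g y)).
Proof.
transitivity (\sum_h \sum_g \sum_x \sum_y
    (w x * w y) * (P h * (c h x * c h y)) * (Q g * (t g x * t g y))).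
  apply: eq_bigr => h _; apply: eq_bigr => g _.
  rewrite expr2 big_distrlr mulr_sumr; apply: eq_bigr => x _ /=.
  by rewrite mulr_sumr; apply: eq_bigr => y _; ring.
under eq_bigr do rewrite exchange_big.
rewrite exchange_big; apply: eq_bigr => x _ /=.
under eq_bigr do rewrite exchange_big.
rewrite exchange_big; apply: eq_bigr => y _ /=.
rewrite -mulrA big_distrlr mulr_sumr; apply: eq_bigr => h _.
by rewrite mulr_sumr; apply: eq_bigr => g _ /=; ring.
Qed.

Section Sketch.
Variables (d q s : nat).
Variables (p : 'I_q -> {ffun 'I_d -> 'I_s.+1} -> R).
Variables (r : 'I_q -> {ffun 'I_d -> bool} -> R).
Hypothesis p2 : forall k, kwise_weights 2 (p k).
Hypothesis r4 : forall k, kwise_weights 4 (r k).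
Local Notation T := {ffun 'I_q -> 'I_d}.
Implicit Types (h : {ffun 'I_q -> {ffun 'I_d -> 'I_s.+1}}).
Implicit Types (g : {ffun 'I_q -> {ffun 'I_d -> bool}}).

(** Collisions of distinct multi-indices only: the diagonal of [S^T S] is
    deterministic, because the signs square to 1. *)
Definition collide h (x : T * T) : R :=
  ((x.1 != x.2) && (tensor_hash h x.1 == tensor_hash h x.2))%:R.

Lemma collide_correlation (x y : T * T) :
  0 <= \sum_h prod_weights p h * (collide h x * collide h y) <= s.+1%:R^-1.
Proof.
have P0 h : 0 <= prod_weights p h by apply: prod_weights_ge0 => k f; exact: (p2 k).1.
have c01 h z : 0 <= collide h z <= 1 by rewrite /collide ler0n lern1 leq_b1.
apply/andP; split.
  apply: sumr_ge0 => h _; rewrite !mulr_ge0 //; by case/andP: (c01 h x); case/andP: (c01 h y).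
have [xx|xx] := eqVneq x.1 x.2.
  rewrite big1 ?invr_ge0 // => h _.
  by rewrite /collide xx eqxx /= mul0r mulr0.
apply: le_trans (tensor_collision p2 xx); apply: ler_sum => h _.
rewrite ler_wpM2l //; apply: (@le_trans _ _ (collide h x)).
  have /andP[cx0 _] := c01 h x; have /andP[_ cy1] := c01 h y.
  by rewrite -[leRHS]mulr1 ler_wpM2l.
by rewrite /collide xx.
Qed.

Lemma sign_correlation (I J K L : T) :
  `|\sum_g prod_weights r g * ((tensor_sign g I * tensor_sign g J) *
       (tensor_sign g K * tensor_sign g L))| <=
  \prod_(k < q) pairings (I k) (J k) (K k) (L k) :> R.
Proof.
rewrite (eq_bigr (fun g => prod_weights r g * \prod_(k < q)
   ((-1) ^+ g k (I k) * (-1) ^+ g k (J k) *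
    (-1) ^+ g k (K k) * (-1) ^+ g k (L k)))); last first.
  by move=> g _; congr (_ * _); rewrite /tensor_sign -!big_split /= ;
    apply: eq_bigr => k _; rewrite !mulrA.
rewrite (sum_prod_weights r (fun k (f : {ffun 'I_d -> bool}) =>
   (-1) ^+ f (I k) * (-1) ^+ f (J k) * (-1) ^+ f (K k) * (-1) ^+ f (L k))).
rewrite normr_prod; apply: ler_prod => k _.
by rewrite normr_ge0 sign_four_point.
Qed.

(** The collision factors are at most [1 / s], the sign factors are at most a
    product of [pairings], and [four_point] sums them against [|u|, |v|]. *)
Lemma sketch_second_moment (u v : T -> R) :
  \sum_h \sum_g prod_weights p h * prod_weights r g *
    (\sum_x collide h x * (tensor_sign g x.1 * tensor_sign g x.2) * (u x.1 * v x.2)) ^+ 2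
  <= 3 ^+ q / s.+1%:R * ((\sum_I u I ^+ 2) * (\sum_I v I ^+ 2)).
Proof.
rewrite (sum_sqr_exchange _ _ collide
  (fun g x => tensor_sign g x.1 * tensor_sign g x.2) (fun x => u x.1 * v x.2)).
apply: (@le_trans _ _ (\sum_(x : T * T) \sum_(y : T * T) s.+1%:R^-1 *
   ((\prod_(k < q) pairings (x.1 k) (x.2 k) (y.1 k) (y.2 k)) *
     (`|u x.1| * `|v x.2| * `|u y.1| * `|v y.2|)))).
  apply: ler_sum => x _; apply: ler_sum => y _.
  apply: le_trans (ler_norm _) _; rewrite !normrM.
  have /andP[c0 c1] := collide_correlation x y; rewrite (ger0_norm c0).
  have sc := sign_correlation x.1 x.2 y.1 y.2.
  rewrite [leRHS](_ : _ = (`|u x.1| * `|v x.2| * (`|u y.1| * `|v y.2|)) * s.+1%:R^-1 *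
    \prod_(k < q) pairings (x.1 k) (x.2 k) (y.1 k) (y.2 k)); last by ring.
  apply: ler_pM => //; first by rewrite !mulr_ge0.
  by rewrite ler_wpM2l // !mulr_ge0.
have norm_sqr (w : T -> R) : l2norm (fun I => `|w I|) ^+ 2 = \sum_I w I ^+ 2.
  by rewrite l2norm_sqr; apply: eq_bigr => I _; rewrite real_normK ?num_real.
have := four_point (fun I => normr_ge0 (u I)) (fun I => normr_ge0 (v I))
  (fun I => normr_ge0 (u I)) (fun I => normr_ge0 (v I)).
rewrite (_ : l2norm _ * _ * _ * _ = (\sum_I u I ^+ 2) * (\sum_I v I ^+ 2)); last first.
  by rewrite -!norm_sqr; ring.
move=> fp.
rewrite mulrAC mulrC.
under eq_bigr do rewrite -mulr_sumr.
rewrite -mulr_sumr ler_wpM2l ?invr_ge0 //.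
apply: le_trans fp; rewrite [leRHS]pair_bigA /=.
rewrite le_eqVlt; apply/orP; left; apply/eqP; apply: eq_bigr => x _.
by rewrite [RHS]pair_bigA.
Qed.

Lemma tensor_sketch_gram h g (c c' : 'I_#|tensor_index d q|) :
  ((tensor_sketch_mx h g)^T *m tensor_sketch_mx h g) c c' =
  (c == c')%:R + collide h (enum_val c, enum_val c') *
     (tensor_sign g (enum_val c) * tensor_sign g (enum_val c')) :> R.
Proof.
set I := enum_val c; set J := enum_val c'.
have sgn2 : tensor_sign g I * tensor_sign g I = 1 :> R.
  rewrite /tensor_sign -big_split big1 // => k _.
  by rewrite /= -expr2 sqrr_sign.
have -> : (c == c') = (I == J) by rewrite (inj_eq enum_val_inj).
have HI : (tensor_hash h I < s.+1)%N by rewrite ltn_pmod.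
rewrite mxE (bigD1 (Ordinal HI)) //= big1 => [|j jI]; last first.
  by rewrite !mxE -/I ifN ?mul0r.
rewrite !mxE -/I -/J /= eqxx addr0 /collide /=.
have [<-|IJ] /= := eqVneq I J; first by rewrite eqxx sgn2 mul0r addr0.
rewrite add0r; case: eqP => _; by rewrite ?mul1r // mulr0 mul0r.
Qed.

Lemma sketch_frob_moment n (A : 'M[R]_(n, #|tensor_index d q|)) :
  \sum_h \sum_g prod_weights p h * prod_weights r g *
    frob2 (A *m ((tensor_sketch_mx h g)^T *m tensor_sketch_mx h g) *m A^T - A *m A^T)
  <= 3 ^+ q / s.+1%:R * frob2 A ^+ 2.
Proof.
pose row (a : 'I_n) (I : T) := A a (enum_rank I).
have entry h g a b :
  (A *m ((tensor_sketch_mx h g)^T *m tensor_sketch_mx h g) *m A^T - A *m A^T) a b =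
  \sum_x collide h x * (tensor_sign g x.1 * tensor_sign g x.2) * (row a x.1 * row b x.2).
  have -> : A *m ((tensor_sketch_mx h g)^T *m tensor_sketch_mx h g) *m A^T - A *m A^T
     = A *m ((tensor_sketch_mx h g)^T *m tensor_sketch_mx h g - 1%:M) *m A^T.
    by rewrite mulmxBr mulmxBl mulmx1.
  rewrite mxE.
  under eq_bigr do rewrite mxE mulr_suml.
  rewrite exchange_big /=.
  rewrite -(pair_bigA _ (fun I J => collide h (I, J) *
    (tensor_sign g I * tensor_sign g J) * (row a I * row b J))) /=.
  rewrite [RHS]big_enum_val /=; apply: eq_bigr => c _.
  rewrite [RHS]big_enum_val /=; apply: eq_bigr => c' _.
  rewrite /row !enum_valK [X in _ * X * _]mxE tensor_sketch_gram !mxE.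
  rewrite -[(c == c')%:R]mulr1n; ring.
have rowE a : \sum_I row a I ^+ 2 = \sum_j A a j ^+ 2.
  by rewrite [LHS]big_enum_val; apply: eq_bigr => j _; rewrite /row enum_valK.
rewrite [X in X <= _](_ : _ = \sum_a \sum_b \sum_h \sum_g prod_weights p h * prod_weights r g *
   (\sum_x collide h x * (tensor_sign g x.1 * tensor_sign g x.2) *
      (row a x.1 * row b x.2)) ^+ 2); last first.
  under [RHS]eq_bigr do rewrite exchange_big.
  rewrite [RHS]exchange_big; apply: eq_bigr => h _ /=.
  under [RHS]eq_bigr do rewrite exchange_big.
  rewrite [RHS]exchange_big; apply: eq_bigr => g _ /=.
  rewrite /frob2 mulr_sumr; apply: eq_bigr => a _.
  by rewrite mulr_sumr; apply: eq_bigr => b _; rewrite entry.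
rewrite /frob2 expr2 big_distrlr mulr_sumr; apply: ler_sum => a _.
rewrite mulr_sumr; apply: ler_sum => b _.
by apply: le_trans (sketch_second_moment _ _) _; rewrite !rowE.
Qed.

End Sketch.
End Moment.

(** * From random functions to finite weights *)

Section Law.
Context {R : realType} {dsp : measure_display} {Omega : measurableType dsp}.
Variable Pr : probability Omega R.

Definition law (X : finType) (Y : Omega -> X) (x : X) : R :=
  fine (Pr (Y @^-1` [set x])).

Section RandomVariable.
Variables (X : finType) (Y : Omega -> X).
Hypothesis mY : forall x, measurable (Y @^-1` [set x]).

Lemma lawE x : Pr (Y @^-1` [set x]) = (law Y x)%:E.
Proof. by rewrite /law fineK // fin_num_measure. Qed.

Lemma law_ge0 x : 0 <= law Y x.
Proof. by rewrite /law fine_ge0 // measure_ge0. Qed.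

Lemma law_preimage (P : pred X) :
  Pr (Y @^-1` [set` P]) = (\sum_(x | P x) law Y x)%:E.
Proof.
have -> : Y @^-1` [set` P] = \bigcup_(x in [set` enum P]) (Y @^-1` [set x]).
  apply/seteqP; split => w /=.
    by move=> Pw; exists (Y w) => //=; rewrite mem_enum.
  by move=> [x /=]; rewrite mem_enum => Px ->.
rewrite measure_fin_bigcup //; last by move=> x y _ _ [w [/= <- <-]].
rewrite -fsbig_seq ?enum_uniq // big_enum /= -sumEFin.
by apply: eq_bigr => x _; rewrite lawE.
Qed.

End RandomVariable.

Lemma kwise_weights_law k (A B : finType) (f : Omega -> {ffun A -> B}) :
  random_function f -> kwise_uniform Pr k f -> kwise_weights k (law f).
Proof.
move=> mf uf; split=> [x|S v Sk]; first exact: law_ge0.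
apply: EFin_inj; rewrite -law_preimage // -(uf S v Sk); congr (Pr _).
apply/seteqP; split => w /=.
  by move=> /forall_inP H a /H /eqP.
by move=> H; apply/forall_inP => a /H ->.
Qed.

Section Joint.
Variables (d q s : nat).
Variables (h : 'I_q -> Omega -> {ffun 'I_d -> 'I_s}).
Variables (g : 'I_q -> Omega -> {ffun 'I_d -> bool}).
Hypothesis rand : tensor_sketch_randomness Pr h g.

Definition joint (w : Omega) : {ffun 'I_q -> {ffun 'I_d -> 'I_s}} *
    {ffun 'I_q -> {ffun 'I_d -> bool}} :=
  ([ffun k => h k w], [ffun k => g k w]).

Lemma joint_preimage y : joint @^-1` [set y] =
  \bigcap_(i in [set` [set: 'I_q + 'I_q]%SET])
    match i with inl k => h k @^-1` [set y.1 k] | inr k => g k @^-1` [set y.2 k] end.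
Proof.
case: y => [y1 y2]; apply/seteqP; split => w /=.
  by move=> [<- <-] [k|k] _ /=; rewrite ffunE.
move=> H; congr (_, _); apply/ffunP => k; rewrite ffunE.
  by have := H (inl k); rewrite /= inE; apply.
by have := H (inr k); rewrite /= inE; apply.
Qed.

Lemma measurable_joint y : measurable (joint @^-1` [set y]).
Proof.
have [mhg _ _ _] := rand.
rewrite joint_preimage.
apply: fin_bigcap_measurable; first exact: finite_finset.
by move=> [k|k] _; have [mh mg] := mhg k; [exact: mh | exact: mg].
Qed.

(** Mutual independence of all [2 q] functions: the joint law is a product. *)
Lemma joint_law y :
  law joint y = prod_weights (fun k => law (h k)) y.1 *
                prod_weights (fun k => law (g k)) y.2.
Proof.
have [mhg _ _ indep] := rand.
apply: EFin_inj; rewrite -lawE; last exact: measurable_joint.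
rewrite joint_preimage indep => [|[k|k] _ /=]; last 2 first.
- by exists [set y.1 k].
- by exists [set y.2 k].
rewrite (eq_bigl xpredT) => [|k]; last by rewrite inE.
rewrite big_sumType /= EFinM /prod_weights -!prodEFin; congr (_ * _)%E.
  by apply: eq_bigr => k _; rewrite lawE //; exact: (mhg k).1.
by apply: eq_bigr => k _; rewrite lawE //; exact: (mhg k).2.
Qed.

End Joint.
End Law.

(** * The sketch satisfies the conditions with high probability *)

Section Features.
Context {R : realType}.

Definition feature_mx n d q (x : 'I_n -> 'cV[R]_d) : 'M[R]_(n, #|tensor_index d q|) :=
  \matrix_(i, c) tensor_power q (x i) c 0.

Lemma poly_kernel_gram n d q (x : 'I_n -> 'cV[R]_d) :
  poly_kernel q x = feature_mx q x *m (feature_mx q x)^T.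
Proof.
apply/matrixP => i j; rewrite !mxE.
transitivity (\prod_(k < q) \sum_l x i l 0 * x j l 0).
  rewrite prodr_const card_ord; congr (_ ^+ _).
  by apply: eq_bigr => l _; rewrite mxE.
rewrite bigA_distr_bigA [LHS]big_enum_val; apply: eq_bigr => c _.
by rewrite !mxE -big_split.
Qed.

Lemma sketched_rows_feature n d q s (x : 'I_n -> 'cV[R]_d)
    (h : 'I_q -> {ffun 'I_d -> 'I_s}) (g : 'I_q -> {ffun 'I_d -> bool}) :
  sketched_rows x h g = feature_mx q x *m (tensor_sketch_mx h g)^T.
Proof.
apply/matrixP => i j; rewrite !mxE; apply: eq_bigr => c _.
by rewrite mulrC; congr (_ * _); rewrite !mxE.
Qed.

Lemma shift_posdef n m (W : 'M[R]_(n, m)) (lambda : R) (u : 'cV[R]_n) :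
  0 < lambda -> u != 0 -> 0 < dotc u ((W *m W^T + lambda%:M) *m u).
Proof.
move=> l0 u0; rewrite dotc_shift dotc_gram ltr_wpDl ?dotc_ge0 // mulr_gt0 //.
by rewrite lt0r dotc_ge0 andbT; apply: contraNneq u0 => /dotc_eq0 ->.
Qed.

Lemma shift_sym n m (W : 'M[R]_(n, m)) (lambda : R) :
  (W *m W^T + lambda%:M)^T = W *m W^T + lambda%:M.
Proof. by rewrite linearD /= gram_sym tr_scalar_mx. Qed.

Lemma frob2_trace m n (A : 'M[R]_(m, n)) : frob2 A = \tr (A *m A^T).
Proof.
rewrite /frob2 /mxtrace; apply: eq_bigr => i _; rewrite mxE.
by apply: eq_bigr => j _; rewrite mxE expr2.
Qed.

(** [A = L^-1 Phi] where [K + lambda = L L^T]. Then [L (A G A^T - A A^T) L^T] is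
    [Phi G Phi^T - K], and [|L^T x|^2] is the quadratic form of [K + lambda]:
    a Frobenius bound turns into a bound relative to that form. *)
Lemma whitening n m (Phi : 'M[R]_(n, m)) (lambda : R) (K := Phi *m Phi^T) :
  0 < lambda -> exists A : 'M[R]_(n, m),
    frob2 A = stat_dim lambda K /\
    forall (G : 'M[R]_m) (x : 'cV[R]_n) (c : R), 0 <= c ->
      frob2 (A *m G *m A^T - A *m A^T) <= c ^+ 2 ->
      `|dotc x (Phi *m G *m Phi^T *m x) - dotc x (K *m x)| <=
        c * dotc x ((K + lambda%:M) *m x).
Proof.
move=> l0.
have [L Lu LE] := posdef_factor (shift_sym Phi lambda) (fun u => shift_posdef Phi l0).
have [A AE] : exists A, A = invmx L *m Phi by exists (invmx L *m Phi).
have PhiE : Phi = L *m A by rewrite AE mulKVmx.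
exists A; split.
  have LTu : L^T \in unitmx by rewrite unitmx_tr.
  have invL : invmx (L *m L^T) *m L = invmx L^T.
    rewrite -[X in _ *m X](mulmxK LTu) mulmxA mulVmx ?mul1mx //.
    by rewrite unitmx_mul Lu.
  rewrite frob2_trace /stat_dim /K LE PhiE trmx_mul !mulmxA invL.
  by rewrite [RHS]mxtrace_mulC !mulmxA mulmxV // mul1mx.
move=> G x c c0 H.
have := dotc_frob (L^T *m x) c0 H; rewrite -dotc_gram -LE.
rewrite dotc_mulmxl trmxK mulmxBl mulmxBr dotcDr dotcNr /K PhiE trmx_mul.
by rewrite !mulmxA.
Qed.

End Features.

(** Markov's inequality for the squared Frobenius error. The constant
    [250 ^+ 2] is the inverse of the squared tolerance of
    [conditions_of_approx]. *)
Lemma tensor_sketch_whp (R : realType) q n d s (x : 'I_n -> 'cV[R]_d) (lambda : R)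
    (m : nat) (V : 'M[R]_(n, m))
    (dsp : measure_display) (Omega : measurableType dsp)
    (Pr : probability Omega R)
    (h : 'I_q -> Omega -> {ffun 'I_d -> 'I_s.+1})
    (g : 'I_q -> Omega -> {ffun 'I_d -> bool}) (delta : R) :
  0 < lambda -> 0 < delta ->
  let K := poly_kernel q x in
  K = V *m V^T ->
  tensor_sketch_randomness Pr h g ->
  (3 ^+ q * 250 ^+ 2) * stat_dim lambda K ^+ 2 / delta <= s.+1%:R ->
  ((1 - delta)%:E <=
    Pr [set w | let Z := sketched_rows x (h ^~ w) (g ^~ w) in
                condition1 lambda K Z /\ condition2 lambda V Z])%E.
Proof.
move=> l0 d0 K KV rand sbound.
have [mhg h3 g4 _] := rand.
pose good (y : {ffun 'I_q -> {ffun 'I_d -> 'I_s.+1}} * {ffun 'I_q -> {ffun 'I_d -> bool}}) :=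
  let Z := sketched_rows x y.1 y.2 in condition1 lambda K Z /\ condition2 lambda V Z.
pose mu := law Pr (joint h g).
have h2 k : kwise_weights 2 (law Pr (h k)).
  by apply: kwise_weightsW (kwise_weights_law (mhg k).1 (h3 k)).
have g4' k : kwise_weights 4 (law Pr (g k)) := kwise_weights_law (mhg k).2 (g4 k).
have muE y : mu y = prod_weights (fun k => law Pr (h k)) y.1 *
                prod_weights (fun k => law Pr (g k)) y.2 := joint_law rand y.
have mu0 y : 0 <= mu y by exact: law_ge0.
have mu1 : \sum_y mu y = 1.
  under eq_bigr do rewrite muE.
  rewrite -(pair_bigA _ (fun a b => prod_weights (fun k => law Pr (h k)) a *
                prod_weights (fun k => law Pr (g k)) b)) -big_distrlr /=.
  rewrite !sum_prod_weights1 ?mul1r // => k.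
    exact: kwise_weights_total true (g4' k).
  exact: kwise_weights_total ord0 (h2 k).
have -> : [set w | let Z := sketched_rows x (h ^~ w) (g ^~ w) in
                condition1 lambda K Z /\ condition2 lambda V Z] =
   joint h g @^-1` [set` (fun y => `[< good y >])].
  have ZE w : sketched_rows x (joint h g w).1 (joint h g w).2 =
      sketched_rows x (h ^~ w) (g ^~ w).
    by congr (sketched_rows x _ _); apply/funext => k; rewrite ffunE.
  apply/seteqP; split => w.
    by move=> H; apply/asboolP; rewrite /good ZE.
  by move=> /asboolP; rewrite /good ZE.
rewrite (law_preimage Pr (measurable_joint rand)) lee_fin.
rewrite -/mu.
pose Phi := feature_mx q x.
have KE : K = Phi *m Phi^T := poly_kernel_gram q x.
have [A [frobA approx]] := whitening Phi l0.
pose err (y : {ffun 'I_q -> {ffun 'I_d -> 'I_s.+1}} * {ffun 'I_q -> {ffun 'I_d -> bool}}) :=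
  let S := tensor_sketch_mx y.1 y.2 in frob2 (A *m (S^T *m S) *m A^T - A *m A^T).
have err_moment : \sum_y mu y * err y <= 3 ^+ q / s.+1%:R * stat_dim lambda K ^+ 2.
  rewrite KE -frobA; apply: le_trans (sketch_frob_moment h2 g4' A).
  rewrite pair_bigA /= le_eqVlt; apply/orP; left; apply/eqP.
  by apply: eq_bigr => y _; rewrite muE.
have good_of_err y : err y <= (1 / 250) ^+ 2 -> good y.
  move=> ey; rewrite /good; set Z := sketched_rows _ _ _; rewrite KV.
  apply: conditions_of_approx => // u; rewrite -KV KE.
  have -> : Z *m Z^T = Phi *m
      ((tensor_sketch_mx y.1 y.2)^T *m tensor_sketch_mx y.1 y.2) *m Phi^T.
    by rewrite /Z sketched_rows_feature trmx_mul trmxK !mulmxA.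
  by apply: approx ey; rewrite divr_ge0 ?ler01 ?ler0n.
have [B [B0 BE Bs]] : exists B : R, [/\ 0 <= B, B * (1 / 250) ^+ 2 = 1 &
    3 ^+ q * B * stat_dim lambda K ^+ 2 <= s.+1%:R * delta].
  exists (250 ^+ 2); split; first exact: sqr_ge0.
    by field.
  by rewrite -ler_pdivrMr.
(* The bad outcomes are those of large error: Markov's inequality. *)
have bad_le : \sum_(y | ~~ `[< good y >]) mu y <= delta.
  apply: (@le_trans _ _ (\sum_y B * (mu y * err y))).
    rewrite big_mkcond; apply: ler_sum => y _.
    have err0 : 0 <= err y by exact: frob2_ge0.
    case: ifP => [bad|_]; last by rewrite !mulr_ge0.
    rewrite mulrCA -[leLHS]mulr1 ler_wpM2l // -BE ler_wpM2l // ltW // ltNge.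
    by apply: contra bad => /good_of_err ?; apply/asboolP.
  rewrite -mulr_sumr; apply: le_trans (ler_wpM2l B0 err_moment) _.
  have -> : B * (3 ^+ q / s.+1%:R * stat_dim lambda K ^+ 2) =
      3 ^+ q * B * stat_dim lambda K ^+ 2 / s.+1%:R by ring.
  by rewrite ler_pdivrMr ?ltr0n // [leRHS]mulrC.
have := mu1; rewrite (bigID (fun y => `[< good y >])) /=; lra.
Qed.

Theorem theorem7 (R : realType) (q : nat) (q_gt0 : (0 < q)%N) :
  (forall (n d s : nat) (x : 'I_n -> 'cV[R]_d) (y : 'cV[R]_n) (lambda : R)
      (m : nat) (V : 'M[R]_(n, m))
      (h : 'I_q -> {ffun 'I_d -> 'I_s}) (g : 'I_q -> {ffun 'I_d -> bool}),
    (0 < n)%N -> (0 < d)%N -> (0 < s)%N -> 0 < lambda ->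
    let K := poly_kernel q x in
    let Z := sketched_rows x h g in
    K = V *m V^T ->
    condition1 lambda K Z -> condition2 lambda V Z ->
    forall eps : R, 0 < eps ->
    let A := K + lambda%:M in
    let c' := pcg_iterate A (Z *m Z^T + lambda%:M) y (pcg_steps eps) in
    forall c : 'cV[R]_n, A *m c = y ->
      normA A (c' - c) <= eps * normA A c)
  /\
  (exists C : R, 0 < C /\
    forall (n d s : nat) (x : 'I_n -> 'cV[R]_d) (lambda : R)
      (m : nat) (V : 'M[R]_(n, m))
      (dsp : measure_display) (Omega : measurableType dsp)
      (Pr : probability Omega R)
      (h : 'I_q -> Omega -> {ffun 'I_d -> 'I_s})
      (g : 'I_q -> Omega -> {ffun 'I_d -> bool}),
    (0 < n)%N -> (0 < d)%N -> (0 < s)%N -> 0 < lambda ->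
    let K := poly_kernel q x in
    K = V *m V^T ->
    tensor_sketch_randomness Pr h g ->
    forall delta : R, 0 < delta < 1 ->
    C * stat_dim lambda K ^+ 2 / delta <= s%:R ->
    ((1 - delta)%:E <=
      Pr [set w | let Z := sketched_rows x (h ^~ w) (g ^~ w) in
                  condition1 lambda K Z /\ condition2 lambda V Z])%E).
Proof.
split.
  move=> [|n] d s x y lambda m V h g n0 _ _ l0 K Z KV c1 c2 eps eps0 A c' c Ac.
    by [].
  rewrite KV in c1; rewrite /c' /A.
  apply: pcg_bound => //; rewrite ?KV ?shift_sym //.
  - by move=> u; exact: shift_posdef.
  - by move=> u; exact: shift_posdef.
  - by move=> u; have [] := preconditioner_equiv l0 u c1 c2.
  - by move=> u; have [] := preconditioner_equiv l0 u c1 c2.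
exists (3 ^+ q * 250 ^+ 2); split; first by rewrite mulr_gt0 ?exprn_gt0.
move=> n d [|s] x lambda m V dsp Omega Pr h g _ _ s0 l0 K KV rand delta /andP[d0 _].
  by [].
exact: tensor_sketch_whp.
Qed.
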